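(* Let $n \in \omega$ and let $\mathcal{I} \subseteq \mathcal{P}(\omega)$ be a Turing jump ideal such that for every lightface $\Delta^0_{n+1}$ set $A \subseteq [\omega]^{\omega}$ there exists some $g \in \mathrm{HS}(A) \cap \mathcal{I}$. Then $\mathsf{HJ}^n(\emptyset) \in \mathcal{I}$.
   Context: A Turing jump ideal is a nonempty set $\mathcal{I}\subseteq\mathcal{P}(\omega)$ closed under $\oplus$, under Turing reducibility downward, and under the Turing jump. The Ramsey space $[\omega]^{\omega}$ is the set of infinite subsets of $\omega$, each identified with its principal (strictly increasing enumerating) function, viewed as a closed subspace of Baire space $\omega^\omega$. For $f \in [\omega]^{\omega}$, $[f]^{\omega}=\{f\circ g : g\in[\omega]^\omega\}$ is the set of infinite subsets of $\mathrm{ran}(f)$. For $A \subseteq [\omega]^{\omega}$, $f$ is homogeneous for $A$ if $[f]^{\omega}\subseteq A$ or $[f]^{\omega}\cap A=\emptyset$; $\mathrm{HS}(A)$ is the set of such $f$. A set $A\subseteq[\omega]^\omega$ is lightface $\Delta^0_{n+1}$ if it is definable both by a $\Sigma^0_{n+1}$ and by a $\Pi^0_{n+1}$ formula of arithmetic without set parameters (in the variable $f$). $\mathsf{HJ}(X)$ denotes the hyperjump of $X$ (e.g. $\{e : \text{the $e$-th $X$-computable tree on $\omega$ has no infinite path}\}$), $\mathsf{HJ}^0(\emptyset)=\emptyset$ and $\mathsf{HJ}^{n+1}(\emptyset)=\mathsf{HJ}(\mathsf{HJ}^n(\emptyset))$. *)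

(* Defs.v *)
From Stdlib Require Import Cantor.
From mathcomp Require Import all_boot.
From mathcomp Require Import boolp classical_sets.

Set Implicit Arguments.
Unset Strict Implicit.
Unset Printing Implicit Defensive.

Local Open Scope classical_set_scope.

(** * Oracle computability

    Kleene's partial recursive functions relative to an oracle, presented as
    unary functions through the Cantor bijection between nat * nat and nat.   *)

Notation cpair x y := (Cantor.to_nat (x, y)).

Inductive code : Type :=
| CConst of nat
| CSucc
| CFst
| CSnd
| COracle
| CPair of code & code
| CComp of code & code
| CPrec of code & code
| CMu of code.

Fixpoint prec_rel (P Q : nat -> nat -> Prop) (x k z : nat) : Prop :=
  match k with
  | 0 => P x z
  | k'.+1 => exists2 y, prec_rel P Q x k' y & Q (cpair x (cpair k' y)) z
  end.

(** [eval X c n y] means: the program [c] with oracle [X] halts on input [n]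
    with output [y].  [CPrec c d] maps <x, 0> to c(x) and <x, k + 1> to
    d(<x, <k, CPrec c d <x, k>>>); [CMu c] maps n to the least i such that
    c(<n, i>) = 0, all earlier values being defined and nonzero.             *)
Fixpoint eval (X : set nat) (c : code) (n y : nat) : Prop :=
  match c with
  | CConst k => y = k
  | CSucc => y = n.+1
  | CFst => y = (Cantor.of_nat n).1
  | CSnd => y = (Cantor.of_nat n).2
  | COracle => (X n /\ y = 1) \/ (~ X n /\ y = 0)
  | CPair c d =>
      exists a b, [/\ eval X c n a, eval X d n b & y = cpair a b]
  | CComp c d => exists2 a, eval X d n a & eval X c a y
  | CPrec c d =>
      prec_rel (eval X c) (eval X d)
        (Cantor.of_nat n).1 (Cantor.of_nat n).2 y
  | CMu c =>
      eval X c (cpair n y) 0 /\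
      forall i, i < y -> exists z, eval X c (cpair n i) z.+1
  end.

(** The index (Goedel number) of a program.  It is injective; a number that is
    not of the form [gnum c] indexes no program.                            *)
Fixpoint gnum (c : code) : nat :=
  match c with
  | CConst k => cpair 0 k
  | CSucc => cpair 1 0
  | CFst => cpair 2 0
  | CSnd => cpair 3 0
  | COracle => cpair 4 0
  | CPair c d => cpair 5 (cpair (gnum c) (gnum d))
  | CComp c d => cpair 6 (cpair (gnum c) (gnum d))
  | CPrec c d => cpair 7 (cpair (gnum c) (gnum d))
  | CMu c => cpair 8 (gnum c)
  end.

Definition computes (X : set nat) (c : code) (A : set nat) : Prop :=
  forall n, (A n -> eval X c n 1) /\ (~ A n -> eval X c n 0).

Definition turing_le (A X : set nat) : Prop := exists c, computes X c A.

Definition turing_join (A B : set nat) : set nat :=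
  [set n.*2 | n in A] `|` [set n.*2.+1 | n in B].

Definition turing_jump (X : set nat) : set nat :=
  [set gnum c | c in [set c | exists y, eval X c (gnum c) y]].

Definition turing_jump_ideal (I : set (set nat)) : Prop :=
  [/\ I !=set0,
      forall A B, I A -> I B -> I (turing_join A B),
      forall A B, turing_le A B -> I B -> I A
    & forall A, I A -> I (turing_jump A)].

(** * Hyperjump *)

Definition is_tree (T : set (seq nat)) : Prop :=
  forall s t, T (s ++ t) -> T s.

Definition infinite_path (T : set (seq nat)) (p : nat -> nat) : Prop :=
  forall k, T (mkseq p k).

(** Finite sequences are coded by the bijection [CodeSeq.code].              *)
Definition hyperjump (X : set nat) : set nat :=
  [set gnum c | c in [set c | exists T : set (seq nat),
     [/\ is_tree T, computes X c (CodeSeq.code @` T)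
       & ~ exists p, infinite_path T p]]].

(** * Formulas of arithmetic in a function variable f

    Number variables are de Bruijn indices into an environment.              *)

Inductive term : Type :=
| TVar of nat
| TZero
| TSucc of term
| TAdd of term & term
| TMul of term & term
| TApp of term.

Inductive formula : Type :=
| FEq of term & term
| FLt of term & term
| FNot of formula
| FAnd of formula & formula
| FOr of formula & formula
| FBEx of term & formula
| FBAll of term & formula
| FEx of formula
| FAll of formula.

Fixpoint term_val (f : nat -> nat) (s : seq nat) (t : term) : nat :=
  match t with
  | TVar i => nth 0 s i
  | TZero => 0
  | TSucc t => (term_val f s t).+1
  | TAdd t u => term_val f s t + term_val f s u
  | TMul t u => term_val f s t * term_val f s u
  | TApp t => f (term_val f s t)
  end.

(** The bounding term of a bounded quantifier lies outside its scope.        *)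
Fixpoint sat (f : nat -> nat) (s : seq nat) (phi : formula) : Prop :=
  match phi with
  | FEq t u => term_val f s t = term_val f s u
  | FLt t u => term_val f s t < term_val f s u
  | FNot phi => ~ sat f s phi
  | FAnd phi psi => sat f s phi /\ sat f s psi
  | FOr phi psi => sat f s phi \/ sat f s psi
  | FBEx t phi => exists2 x, x < term_val f s t & sat f (x :: s) phi
  | FBAll t phi => forall x, x < term_val f s t -> sat f (x :: s) phi
  | FEx phi => exists x, sat f (x :: s) phi
  | FAll phi => forall x, sat f (x :: s) phi
  end.

Fixpoint bounded (phi : formula) : bool :=
  match phi with
  | FEq _ _ | FLt _ _ => true
  | FNot phi => bounded phi
  | FAnd phi psi | FOr phi psi => bounded phi && bounded psi
  | FBEx _ phi | FBAll _ phi => bounded phi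
  | FEx _ | FAll _ => false
  end.

(** [Sigma0 k phi] (resp. [Pi0 k phi]): [phi] consists of k alternating blocks
    of unbounded quantifiers, the outermost existential (resp. universal),
    followed by a bounded formula.                                           *)
Inductive Sigma0 : nat -> formula -> Prop :=
| Sigma0_bounded phi : bounded phi -> Sigma0 0 phi
| Sigma0_Pi0 k phi : Pi0 k phi -> Sigma0 k.+1 phi
| Sigma0_Ex k phi : Sigma0 k.+1 phi -> Sigma0 k.+1 (FEx phi)
with Pi0 : nat -> formula -> Prop :=
| Pi0_bounded phi : bounded phi -> Pi0 0 phi
| Pi0_Sigma0 k phi : Sigma0 k phi -> Pi0 k.+1 phi
| Pi0_All k phi : Pi0 k.+1 phi -> Pi0 k.+1 (FAll phi).

(** * The Ramsey space

    An infinite subset of omega is represented by its principal function;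
    as a subset of omega it is the range of that function.                   *)

Definition ramsey_space : set (nat -> nat) :=
  [set f | {homo f : x y / x < y}].

(** Sentences are evaluated in the empty environment, where a stray free
    number variable reads as 0.                                              *)
Definition defined_by (phi : formula) : set (nat -> nat) :=
  [set f | ramsey_space f /\ sat f [::] phi].

Definition lightface_Delta0 (k : nat) (A : set (nat -> nat)) : Prop :=
  (exists2 phi, Sigma0 k phi & A = defined_by phi) /\
  (exists2 psi, Pi0 k psi & A = defined_by psi).

Definition infinite_subsets (f : nat -> nat) : set (nat -> nat) :=
  [set f \o g | g in ramsey_space].

Definition homogeneous_solutions (A : set (nat -> nat)) : set (nat -> nat) :=
  [set f | ramsey_space f /\
     (infinite_subsets f `<=` A \/ infinite_subsets f `&` A = set0)].

(* Main.v *)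
(** The statement "program [x] is not in the hyperjump of [X]" has the form: some function [p]
    passes every stage [j] of a bounded condition.  Here [p] codes the table of all values of all
    programs with oracle [X], together with a sequence witnessing that [x] is not total, or not a
    tree, or has an infinite path.  Let [B(f, x, d)] say that for every [k] some number below
    [f (d + k + 1)] codes a function which is bounded by [f (d + i)] for [i < k] and passes the
    first [k] stages.  By compactness [B(f, x, d)] always refutes membership, and it holds for
    non-members when [f] grows fast enough.  Replacing the oracle, the [m]-th hyperjump, by its own
    description in terms of [f], one gets a [Pi_{m+1}] condition [B_m(f, x, d)], so that the set of
    the [f] with

      [B_m(f, x, 1) <-> B_m(f, x, 2)] for all [m < n] and [x < f 0]

    is [Delta_{n+1}].  It contains every sparse enough set, hence all infinite subsets of a
    homogeneous [g].  On these, [B_m] is insensitive to the deletion of elements other than the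
    least, so it agrees with its value on sparse subsets, and the [n]-th hyperjump is arithmetical
    in [g]. *)

Require Import Defs.
From Stdlib Require Import Cantor.
From mathcomp Require Import all_boot zify.
From mathcomp Require Import boolp classical_sets.

Set Implicit Arguments.
Unset Strict Implicit.
Unset Printing Implicit Defensive.

Local Open Scope classical_set_scope.

(** * Jump ideals are closed under arithmetical definability *)

Arguments Cantor.to_nat : simpl never.
Arguments Cantor.of_nat : simpl never.

Notation pfst n := (Cantor.of_nat n).1.
Notation psnd n := (Cantor.of_nat n).2.

Lemma pfst_cpair x y : pfst (cpair x y) = x.
Proof. by rewrite Cantor.cancel_of_to. Qed.

Lemma psnd_cpair x y : psnd (cpair x y) = y.
Proof. by rewrite Cantor.cancel_of_to. Qed.

Definition cpairE := (pfst_cpair, psnd_cpair).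

Lemma cpairK n : cpair (pfst n) (psnd n) = n.
Proof. by rewrite -surjective_pairing Cantor.cancel_to_of. Qed.

Lemma cpair_inj x y x' y' : cpair x y = cpair x' y' -> x = x' /\ y = y'.
Proof. by move/(congr1 Cantor.of_nat); rewrite !Cantor.cancel_of_to => -[]. Qed.

Lemma cpair_double x y :
  cpair x y + cpair x y = (x + y) * (x + y).+1 + y + y.
Proof.
have := Cantor.to_nat_spec x y; move: (cpair x y) => z; lia.
Qed.

Lemma gnum_inj : injective gnum.
Proof.
elim=> [k|||||c IHc d IHd|c IHc d IHd|c IHc d IHd|c IHc]
  [k'|||||c' d'|c' d'|c' d'|c'] //= /cpair_inj[] // _.
- by move->.
- by case/cpair_inj=> /IHc-> /IHd->.
- by case/cpair_inj=> /IHc-> /IHd->.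
- by case/cpair_inj=> /IHc-> /IHd->.
- by move/IHc->.
Qed.

Lemma eval_det X c n y z : eval X c n y -> eval X c n z -> y = z.
Proof.
elim: c n y z => [k|||||c IHc d IHd|c IHc d IHd|c IHc d IHd|c IHc] n y z /=.
1-4: by move=> -> ->.
- by move=> [[? ->]|[? ->]] [[? ->]|[? ->]].
- by move=> [a [b [ca db ->]]] [a' [b' [/(IHc _ _ _ ca)<- /(IHd _ _ _ db)<- ->]]].
- by move=> [a da ca] [a' /(IHd _ _ _ da)<- /(IHc _ _ _ ca)].
- elim: (psnd n) y z => [|k IHk] y z /=; first exact: IHc.
  by move=> [a /IHk ka da] [a' /ka<- /(IHd _ _ _ da)].
- move=> [c0 cpos] [c0' cpos']; case: (ltngtP y z) => // lt.
    by have [w /(IHc _ _ _ c0)] := cpos' _ lt.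
  by have [w /(IHc _ _ _ c0')] := cpos _ lt.
Qed.

(** * Total functions recursive in an oracle *)

Definition recursive_in (X : set nat) (F : nat -> nat) : Prop :=
  exists c, forall n, eval X c n (F n).

Fixpoint primrec (F G : nat -> nat) (x k : nat) : nat :=
  if k is k'.+1 then G (cpair x (cpair k' (primrec F G x k'))) else F x.

Lemma recursive_ext X F G : F =1 G -> recursive_in X F -> recursive_in X G.
Proof. by move=> FG [c cF]; exists c => n; rewrite -FG. Qed.

Lemma recursive_const X k : recursive_in X (fun=> k).
Proof. by exists (CConst k). Qed.

Lemma recursive_comp X F G :
  recursive_in X F -> recursive_in X G -> recursive_in X (F \o G).
Proof. by move=> [c cF] [d dG]; exists (CComp c d) => n /=; exists (G n). Qed.

Lemma recursive_succ X F : recursive_in X F -> recursive_in X (fun n => (F n).+1).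
Proof. by apply: (@recursive_comp _ S); exists CSucc. Qed.

Lemma recursive_fst X F : recursive_in X F -> recursive_in X (fun n => pfst (F n)).
Proof. by apply: (@recursive_comp _ (fun n => pfst n)); exists CFst. Qed.

Lemma recursive_snd X F : recursive_in X F -> recursive_in X (fun n => psnd (F n)).
Proof. by apply: (@recursive_comp _ (fun n => psnd n)); exists CSnd. Qed.

Lemma recursive_pair X F G :
  recursive_in X F -> recursive_in X G ->
  recursive_in X (fun n => cpair (F n) (G n)).
Proof.
by move=> [c cF] [d dG]; exists (CPair c d) => n /=; exists (F n), (G n).
Qed.

Lemma recursive_id X : recursive_in X id.
Proof.
apply: (@recursive_ext _ (fun n => cpair (pfst n) (psnd n))); first exact: cpairK.
by apply: recursive_pair; [exists CFst|exists CSnd].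
Qed.

Lemma recursive_oracle X F :
  recursive_in X F -> recursive_in X (fun n => `[< X (F n) >] : nat).
Proof.
apply: (@recursive_comp _ (fun n => `[< X n >] : nat)); exists COracle => n /=.
by case: asboolP; [left|right].
Qed.

Lemma recursive_prec X F G A B :
  recursive_in X F -> recursive_in X G -> recursive_in X A -> recursive_in X B ->
  recursive_in X (fun n => primrec F G (A n) (B n)).
Proof.
move=> [c cF] [d dG] rA rB.
suff r : recursive_in X (fun n => primrec F G (pfst n) (psnd n)).
  apply: recursive_ext (recursive_comp r (recursive_pair rA rB)) => n /=.
  by rewrite !cpairE.
exists (CPrec c d) => n /=; elim: (psnd n) => [|k IHk] //=.
by exists (primrec F G (pfst n) k).
Qed.

Lemma recursive_mu X F (m : nat -> nat) :
  recursive_in X F ->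
  (forall n, F (cpair n (m n)) = 0 /\ forall i, i < m n -> F (cpair n i) != 0) ->
  recursive_in X m.
Proof.
move=> [c cF] mP; exists (CMu c) => n /=; have [m0 mpos] := mP n.
split=> [|i /mpos]; first by rewrite -m0.
by rewrite -lt0n => F0; exists (F (cpair n i)).-1; rewrite prednK.
Qed.

Lemma recursive_add X F G :
  recursive_in X F -> recursive_in X G -> recursive_in X (fun n => F n + G n).
Proof.
have r : recursive_in X (fun n => (psnd (psnd n)).+1).
  by do 3?[apply: recursive_succ|apply: recursive_snd]; apply: recursive_id.
move=> rF rG.
apply: recursive_ext (recursive_prec (recursive_id X) r rF rG) => n.
by elim: (G n) => [|k /= ->]; rewrite ?addn0 // !cpairE addnS.
Qed.

Lemma recursive_mul X F G :
  recursive_in X F -> recursive_in X G -> recursive_in X (fun n => F n * G n).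
Proof.
have r : recursive_in X (fun n => pfst n + psnd (psnd n)).
  by apply: recursive_add; do 2?[apply: recursive_fst|apply: recursive_snd];
    apply: recursive_id.
move=> rF rG.
apply: recursive_ext (recursive_prec (recursive_const X 0) r rF rG) => n.
by elim: (G n) => [|k /= ->]; rewrite ?muln0 // !cpairE mulnS.
Qed.

Lemma recursive_sub X F G :
  recursive_in X F -> recursive_in X G -> recursive_in X (fun n => F n - G n).
Proof.
have rpred H : recursive_in X H -> recursive_in X (fun n => (H n).-1).
  have r : recursive_in X (fun n => pfst (psnd n)).
    by apply: recursive_fst; apply: recursive_snd; apply: recursive_id.
  move=> rH; have r0 := recursive_const X 0.
  apply: recursive_ext (recursive_prec r0 r r0 rH) => n.
  by case: (H n) => //= k; rewrite !cpairE.
have r : recursive_in X (fun n => (psnd (psnd n)).-1).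
  by apply: rpred; do 2?apply: recursive_snd; apply: recursive_id.
move=> rF rG.
apply: recursive_ext (recursive_prec (recursive_id X) r rF rG) => n.
by elim: (G n) => [|k /= ->]; rewrite ?subn0 // !cpairE subnS.
Qed.

Lemma turing_leP A X :
  turing_le A X <-> recursive_in X (fun n => `[< A n >] : nat).
Proof.
split=> [[c cA]|[c cA]]; exists c => n.
  by have [A1 A0] := cA n; case: asboolP => /= [/A1|/A0].
by split=> An; have := cA n; [rewrite asboolT|rewrite asboolF].
Qed.

(** From [z], an unbounded search finds the distance [m z] to the next element of [X]; iterating
    this search from 0 enumerates [X] in increasing order. *)
Lemma principal_function_recursive X g :
  ramsey_space g -> range g = X -> recursive_in X g.
Proof.
move=> gincr gX.
have exm z : exists i, `[< X (z + i) >].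
  exists (g z - z); apply/asboolP; rewrite -gX; exists z => //.
  have : z <= g z by elim: z => // z IH; apply: leq_ltn_trans IH (gincr _ _ _).
  by lia.
pose m z := ex_minn (exm z).
have rm : recursive_in X m.
  apply: (@recursive_mu _ (fun n => 1 - (`[< X (pfst n + psnd n) >] : nat))).
    apply: recursive_sub; first exact: recursive_const.
    by apply: recursive_oracle; apply: recursive_add;
      [apply: recursive_fst|apply: recursive_snd]; apply: recursive_id.
  move=> n; rewrite !cpairE /m; case: ex_minnP => i -> imin; split=> // j ji.
  rewrite !cpairE; case E : `[< _ >] => //=; have := imin _ E; lia.
have r0 := recursive_const X (m 0).
have rS : recursive_in X (fun n => (psnd (psnd n)).+1 + m (psnd (psnd n)).+1).
  have rs : recursive_in X (fun n => (psnd (psnd n)).+1).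
    by apply: recursive_succ; do 2?apply: recursive_snd; apply: recursive_id.
  by apply: recursive_add => //; apply: recursive_comp rm rs.
apply: recursive_ext
  (recursive_prec r0 rS (recursive_const X 0) (recursive_id X)) => n /=.
have gmono := leq_mono gincr.
elim: n => [|n /= ->] /=; rewrite ?cpairE /m; case: ex_minnP => i /asboolP.
  rewrite -gX add0n => -[k _ <-] /(_ (g 0)); rewrite gmono.
  have -> : `[< range g (0 + g 0) >] by apply/asboolP; exists 0.
  by move/(_ isT); rewrite leqn0 => /eqP->.
rewrite -gX => -[k _ gk].
have lnk : n < k by have := leqW_mono gmono n k; lia.
have lgn := gincr _ _ (ltnSn n).
move/(_ (g n.+1 - (g n).+1)); rewrite subnKC //.
have -> : `[< range g (g n.+1) >] by apply/asboolP; exists n.+1.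
move/(_ isT); have := gmono n.+1 k; lia.
Qed.

(** Environments become numbers by nested pairing, with the length as a parameter, so that prefixing
    a value [x] is the map from [n] to [cpair x n]. *)
Fixpoint decode_env (L n : nat) : seq nat :=
  if L is L'.+1 then pfst n :: decode_env L' (psnd n) else [::].

Lemma recursive_term X f L t :
  recursive_in X f -> recursive_in X (fun n => term_val f (decode_env L n) t).
Proof.
move=> rf; elim: t => [i||t IH|t IHt u IHu|t IHt u IHu|t IH] /=.
- elim: L i => [|L IHL] i /=; first by rewrite nth_nil; apply: recursive_const.
  case: i => [|i] /=; first by exists CFst.
  by apply: recursive_comp (IHL i) _; exists CSnd.
- exact: recursive_const.
- exact: recursive_succ.
- exact: recursive_add.
- exact: recursive_mul.
- exact: recursive_comp rf IH.
Qed.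

(** * Closure of a jump ideal under the logical operations *)

Lemma ideal_setC I A : turing_jump_ideal I -> I A -> I (~` A).
Proof.
move=> [_ _ down _] IA; apply: down IA; apply/turing_leP.
have := recursive_sub (recursive_const A 1) (recursive_oracle (recursive_id A)).
apply: recursive_ext => n.
by case: (asboolP (A n)) => An; [rewrite asboolF|rewrite asboolT].
Qed.

Lemma ideal_setI I A B : turing_jump_ideal I -> I A -> I B -> I (A `&` B).
Proof.
move=> [_ join down _] IA IB; apply: down (join _ _ IA IB); apply/turing_leP.
set J := turing_join A B.
have JA n : J (n + n) <-> A n.
  rewrite addnn; split=> [[[m Am /double_inj<-]//|[m _]]|An]; first by lia.
  by left; exists n.
have JB n : J (n + n).+1 <-> B n.
  rewrite addnn; split=> [[[m _]|[m Bm /succn_inj/double_inj<-]//]|Bn]; first by lia.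
  by right; exists n.
have rid := recursive_id J; have radd := recursive_add rid rid.
apply: recursive_ext
  (recursive_mul (recursive_oracle radd) (recursive_oracle (recursive_succ radd))).
move=> n /=; rewrite mulnb -asbool_and; congr nat_of_bool.
by apply: asbool_equiv_eq; rewrite /setI /= JA JB.
Qed.

(** The search for a witness, with [n] built in as input, halts exactly when there is one. The index
    of this program is computable from [n], so the jump decides the question. *)
Lemma ideal_exists I A : turing_jump_ideal I -> I A ->
  I [set n | exists x, A (cpair x n)].
Proof.
move=> [_ _ down jump] IA; apply: down (jump _ IA).
have [c cA] : recursive_in A
    (fun n => 1 - (`[< A (cpair (psnd n) (pfst n)) >] : nat)).
  apply: recursive_sub; first exact: recursive_const.
  by apply: recursive_oracle; apply: recursive_pair;
    [apply: recursive_snd|apply: recursive_fst]; apply: recursive_id.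
apply/turing_leP; set J := turing_jump A.
(* This is the index of [CComp (CMu c) (CConst n)]. The jump runs a program on its own index, and
   the constant program replaces that input by [n]. *)
pose h n := cpair 6 (cpair (gnum (CMu c)) (cpair 0 n)).
have rh : recursive_in J h.
  by do 3?[apply: recursive_pair; first exact: recursive_const]; apply: recursive_id.
apply: recursive_ext (recursive_oracle rh) => n; congr nat_of_bool.
apply: asbool_equiv_eq; rewrite /J /turing_jump /=; split.
  move=> [d [y dy] dh]; have {dh}e : d = CComp (CMu c) (CConst n).
    by apply: gnum_inj; rewrite dh.
  move: dy; rewrite e => -[_ -> /= [c0 _]]; exists y.
  have := eval_det c0 (cA _); rewrite !cpairE.
  by case: asboolP.
move=> exA; exists (CComp (CMu c) (CConst n)) => //.
have exA' : exists x, `[< A (cpair x n) >] by case: exA => x /asboolP; exists x.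
exists (ex_minn exA'); exists n => //=; case: ex_minnP => x Ax xmin; split.
  by have := cA (cpair n x); rewrite !cpairE Ax.
move=> i ix; exists 0; have := cA (cpair n i); rewrite !cpairE.
by case E : `[< _ >] => //; have := xmin _ E; lia.
Qed.

(** Each existential quantifier costs one jump, and universal ones follow by complements. Bounded
    quantifiers are treated as unbounded ones with a recursive guard. *)
Lemma ideal_definable I X f : turing_jump_ideal I -> I X -> recursive_in X f ->
  forall phi L, I [set n | sat f (decode_env L n) phi].
Proof.
move=> HI IX rf phi; have [_ _ down _] := HI.
have Ieq t u L : I [set n | term_val f (decode_env L n) t = term_val f (decode_env L n) u].
  apply: down IX; apply/turing_leP.
  have rt := recursive_term L t rf; have ru := recursive_term L u rf.
  apply: recursive_ext (recursive_sub (recursive_const X 1)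
    (recursive_add (recursive_sub rt ru) (recursive_sub ru rt))) => n /=.
  by case: asboolP => /=; lia.
have Ilt t u L : I [set n | term_val f (decode_env L n) t < term_val f (decode_env L n) u].
  apply: down IX; apply/turing_leP.
  have rt := recursive_term L t rf; have ru := recursive_term L u rf.
  apply: recursive_ext (recursive_sub (recursive_const X 1)
    (recursive_sub (recursive_succ rt) ru)) => n /=.
  by case: asboolP => /=; lia.
have Iex psi L : (forall L, I [set n | sat f (decode_env L n) psi]) ->
    I [set n | exists x, sat f (x :: decode_env L n) psi].
  move=> /(_ L.+1)/(ideal_exists HI); congr I; apply/funext => n /=.
  by under [in LHS]eq_exists do rewrite !cpairE.
have Iexb t psi L : (forall L, I [set n | sat f (decode_env L n) psi]) ->
    I [set n | exists2 x, x < term_val f (decode_env L n) t &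
                          sat f (x :: decode_env L n) psi].
  move=> Ipsi.
  have /(ideal_exists HI) :
      I [set n | pfst n < term_val f (decode_env L (psnd n)) t
                 /\ sat f (decode_env L.+1 n) psi].
    apply: (@ideal_setI _ [set n | pfst n < term_val f (decode_env L (psnd n)) t] _ HI) (Ipsi L.+1).
    apply: down IX; apply/turing_leP.
    have rid := recursive_id X.
    have rt := recursive_comp (recursive_term L t rf) (recursive_snd rid).
    apply: recursive_ext (recursive_sub (recursive_const X 1)
      (recursive_sub (recursive_succ (recursive_fst rid)) rt)) => n /=.
    by case: asboolP => /=; lia.
  congr I; apply/funext => n /=; apply/propext.
  by split=> [[x []]|[x xt xpsi]]; first rewrite !cpairE; exists x; rewrite ?cpairE.
elim: phi => [t u|t u|phi IH|phi IHp psi IHq|phi IHp psi IHq|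
  t phi IH|t phi IH|phi IH|phi IH] L /=.
- exact: Ieq.
- exact: Ilt.
- exact: ideal_setC HI (IH L).
- exact: ideal_setI HI (IHp L) (IHq L).
- rewrite (_ : [set _ | _] =
      ~` (~` [set n | sat f (decode_env L n) phi] `&` ~` [set n | sat f (decode_env L n) psi])).
    by apply: (ideal_setC HI); apply: (ideal_setI HI); apply: (ideal_setC HI).
  by rewrite setCI !setCK.
- exact: Iexb IH.
- have /(ideal_setC HI) := Iexb t (FNot phi) L (fun L => ideal_setC HI (IH L)).
  congr I; apply/funext => n /=; apply/propext; split=> [nex x xt|all [x /all]//].
  by apply: contrapT => nphi; apply: nex; exists x.
- exact: Iex IH.
- have /(ideal_setC HI) := Iex (FNot phi) L (fun L => ideal_setC HI (IH L)).
  congr I; apply/funext => n /=; apply/propext; split=> [nex x|all [x /(_ (all x))]//].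
  by apply: contrapT => nphi; apply: nex; exists x.
Qed.

(** * Semantic arithmetical hierarchy *)

Fixpoint term_subst (sigma : nat -> term) (t : term) : term :=
  match t with
  | TVar i => sigma i
  | TZero => TZero
  | TSucc t => TSucc (term_subst sigma t)
  | TAdd t u => TAdd (term_subst sigma t) (term_subst sigma u)
  | TMul t u => TMul (term_subst sigma t) (term_subst sigma u)
  | TApp t => TApp (term_subst sigma t)
  end.

Definition term_shift : term -> term := term_subst (fun i => TVar i.+1).

Definition subst_up (sigma : nat -> term) (i : nat) : term :=
  if i is j.+1 then term_shift (sigma j) else TVar 0.

Fixpoint formula_subst (sigma : nat -> term) (phi : formula) : formula :=
  match phi with
  | FEq t u => FEq (term_subst sigma t) (term_subst sigma u)
  | FLt t u => FLt (term_subst sigma t) (term_subst sigma u)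
  | FNot phi => FNot (formula_subst sigma phi)
  | FAnd phi psi => FAnd (formula_subst sigma phi) (formula_subst sigma psi)
  | FOr phi psi => FOr (formula_subst sigma phi) (formula_subst sigma psi)
  | FBEx t phi => FBEx (term_subst sigma t) (formula_subst (subst_up sigma) phi)
  | FBAll t phi => FBAll (term_subst sigma t) (formula_subst (subst_up sigma) phi)
  | FEx phi => FEx (formula_subst (subst_up sigma) phi)
  | FAll phi => FAll (formula_subst (subst_up sigma) phi)
  end.

Definition env_subst f sigma (s s' : seq nat) : Prop :=
  forall i, nth 0 s' i = term_val f s (sigma i).

Lemma term_val_subst f sigma s s' t : env_subst f sigma s s' ->
  term_val f s (term_subst sigma t) = term_val f s' t.
Proof.
by move=> e; elim: t => [i||t /= ->|t /= -> u ->|t /= -> u ->|t /= ->] /=.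
Qed.

Lemma term_val_shift f x s t : term_val f (x :: s) (term_shift t) = term_val f s t.
Proof. exact: term_val_subst. Qed.

Lemma env_subst_up f sigma s s' x : env_subst f sigma s s' ->
  env_subst f (subst_up sigma) (x :: s) (x :: s').
Proof. by move=> e [|i] //=; rewrite term_val_shift. Qed.

Lemma sat_subst f sigma s s' phi : env_subst f sigma s s' ->
  sat f s (formula_subst sigma phi) <-> sat f s' phi.
Proof.
elim: phi sigma s s' => [t u|t u|phi IH|phi IHp psi IHq|phi IHp psi IHq|
  t phi IH|t phi IH|phi IH|phi IH] sigma s s' e /=;
  rewrite ?(term_val_subst _ e) //.
- by rewrite (IH _ _ _ e).
- by rewrite (IHp _ _ _ e) (IHq _ _ _ e).
- by rewrite (IHp _ _ _ e) (IHq _ _ _ e).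
- by split=> -[x xt xphi]; exists x => //; move: xphi; rewrite (IH _ _ _ (env_subst_up x e)).
- by split=> H x /H; rewrite (IH _ _ _ (env_subst_up x e)).
- by split=> -[x]; rewrite ?(IH _ _ _ (env_subst_up x e)) => xphi; exists x;
    rewrite ?(IH _ _ _ (env_subst_up x e)).
- by split=> H x; move: (H x); rewrite (IH _ _ _ (env_subst_up x e)).
Qed.

Lemma bounded_subst sigma phi : bounded (formula_subst sigma phi) = bounded phi.
Proof.
by elim: phi sigma => //= [phi IHp psi IHq|phi IHp psi IHq] sigma; rewrite IHp IHq.
Qed.

(** Environments being finite lists, an arbitrary [sigma] may need an infinite one. *)
Definition realizable (sigma : nat -> term) : Prop :=
  forall f s, exists s', env_subst f sigma s s'.

Lemma realizable_up sigma : realizable sigma -> realizable (subst_up sigma).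
Proof.
move=> r f s; have [s' e] := r f (behead s); exists (head 0 s :: s') => -[|i] /=.
  by rewrite nth0.
by rewrite e; apply/esym/term_val_subst => j /=; rewrite nth_behead.
Qed.

Definition formula_equiv (phi psi : formula) : Prop :=
  forall f s, sat f s phi <-> sat f s psi.

(** Stated for an arbitrary class, so that closure passes from Sigma to Pi by [closed_dual] and
    climbs the hierarchy by [closed_exists]. *)
Record bounded_closed (C : formula -> Prop) : Prop := BoundedClosed {
  closed_equiv : forall phi psi, formula_equiv phi psi -> C phi -> C psi;
  closed_subst : forall sigma phi, realizable sigma -> C phi -> C (formula_subst sigma phi);
  closed_and : forall phi psi, C phi -> C psi -> C (FAnd phi psi);
  closed_or : forall phi psi, C phi -> C psi -> C (FOr phi psi);
  closed_bex : forall t phi, C phi -> C (FBEx t phi);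
  closed_ball : forall t phi, C phi -> C (FBAll t phi) }.

(** Unlike [Sigma0], closed under equivalence, and with a single quantifier in each block. *)
Fixpoint sigma_class (k : nat) (phi : formula) : Prop :=
  if k is k'.+1 then
    exists2 psi, sigma_class k' (FNot psi) & formula_equiv phi (FEx psi)
  else exists2 psi, bounded psi & formula_equiv phi psi.

Definition pi_class (k : nat) (phi : formula) : Prop := sigma_class k (FNot phi).

Definition delta_class (k : nat) (phi : formula) : Prop :=
  sigma_class k phi /\ pi_class k phi.

Lemma closed_dual C : bounded_closed C -> bounded_closed (fun phi => C (FNot phi)).
Proof.
move=> [Ceq Csub Cand Cor Cbex Cball]; split.
- by move=> phi psi e; apply: Ceq => f s /=; rewrite (e f s).
- by move=> sigma phi r /(Csub _ _ r).
- move=> phi psi Cphi /(Cor _ _ Cphi); apply: Ceq => f s /=.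
  by rewrite not_andP.
- move=> phi psi Cphi /(Cand _ _ Cphi); apply: Ceq => f s /=.
  by rewrite not_orP.
- move=> t phi /(Cball t); apply: Ceq => f s /=.
  by split=> [H [x /H]//|H x xt xphi]; apply: H; exists x.
- move=> t phi /(Cbex t); apply: Ceq => f s /=.
  split=> [[x xt nphi] /(_ x xt)//|H]; apply: contrapT => nex; apply: H => x xt.
  by apply: contrapT => nphi; apply: nex; exists x.
Qed.

(** A common bound replaces a pair of witnesses, so two unbounded quantifiers merge into one without
    a pairing term. *)
Lemma pair_collect (P Q : nat -> Prop) :
  (exists b, (exists2 x, x < b & P x) /\ (exists2 y, y < b & Q y)) <->
  (exists x, P x) /\ (exists y, Q y).
Proof.
split=> [[b [[x _ Px] [y _ Qy]]]|[[x Px] [y Qy]]].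
  by split; [exists x|exists y].
by exists (x + y).+1; split; [exists x|exists y] => //; lia.
Qed.

Lemma bounded_collect (t : nat) (R : nat -> nat -> Prop) :
  (forall x, x < t -> exists y, R x y) ->
  exists b, forall x, x < t -> exists2 y, y < b & R x y.
Proof.
elim: t => [|t IHt] H; first by exists 0.
have [x xt|b Hb] := IHt; first by apply: H; lia.
have [y Ry] := H t (leqnn _); exists (b + y).+1 => x; rewrite ltnS leq_eqVlt.
by case/orP => [/eqP->|/Hb[z zb Rz]]; [exists y|exists z] => //; lia.
Qed.

(** [ren_skip] and [ren_skip2] make room for the variable of a common bound, placed just outside the
    one or two innermost variables. *)
Definition ren_skip (i : nat) : term := if i is j.+1 then TVar j.+2 else TVar 0.
Definition ren_skip2 (i : nat) : term := if i is j.+2 then TVar j.+3 else TVar i.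
Definition ren_swap (i : nat) : term :=
  match i with 0 => TVar 1 | 1 => TVar 0 | j => TVar j end.

Lemma realizable_skip : realizable ren_skip.
Proof. by move=> f s; exists (nth 0 s 0 :: drop 2 s) => -[|i] //=; rewrite nth_drop. Qed.

Lemma realizable_skip2 : realizable ren_skip2.
Proof.
move=> f s; exists (nth 0 s 0 :: nth 0 s 1 :: drop 3 s) => -[|[|i]] //=.
by rewrite nth_drop.
Qed.

Lemma realizable_swap : realizable ren_swap.
Proof.
move=> f s; exists (nth 0 s 1 :: nth 0 s 0 :: drop 2 s) => -[|[|i]] //=.
by rewrite nth_drop.
Qed.

Lemma realizable_shift : realizable (fun i => TVar i.+1).
Proof. by move=> f s; exists (behead s) => i; rewrite nth_behead. Qed.

Lemma sat_skip f x y s phi :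
  sat f (x :: y :: s) (formula_subst ren_skip phi) <-> sat f (x :: s) phi.
Proof. by apply: sat_subst => -[]. Qed.

Lemma sat_skip2 f x y z s phi :
  sat f (x :: y :: z :: s) (formula_subst ren_skip2 phi) <-> sat f (x :: y :: s) phi.
Proof. by apply: sat_subst => -[|[]]. Qed.

Lemma sat_swap f x y s phi :
  sat f (x :: y :: s) (formula_subst ren_swap phi) <-> sat f (y :: x :: s) phi.
Proof. by apply: sat_subst => -[|[]]. Qed.

Lemma sat_shift f x s phi :
  sat f (x :: s) (formula_subst (fun i => TVar i.+1) phi) <-> sat f s phi.
Proof. exact: sat_subst. Qed.

Definition exists_of (C : formula -> Prop) (phi : formula) : Prop :=
  exists2 psi, C psi & formula_equiv phi (FEx psi).

(** The unbounded quantifier is pulled outwards: a common bound handles conjunctions, and collection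
    bounds the witnesses below a bounded universal quantifier. *)
Lemma closed_exists C : bounded_closed C -> bounded_closed (exists_of C).
Proof.
move=> [Ceq Csub Cand Cor Cbex Cball]; split.
- move=> phi psi e [chi Cchi E]; exists chi => // f s.
  by rewrite -(e f s); apply: E.
- move=> sigma phi r [psi Cpsi E]; exists (formula_subst (subst_up sigma) psi).
    exact: Csub (realizable_up r) Cpsi.
  move=> f s; have [s' e] := r f s; rewrite (sat_subst _ e) (E f s') /=.
  by split=> -[x H]; exists x; move: H; rewrite (sat_subst _ (env_subst_up x e)).
- move=> phi psi [phi' Cphi Ephi] [psi' Cpsi Epsi].
  exists (FAnd (FBEx (TVar 0) (formula_subst ren_skip phi'))
               (FBEx (TVar 0) (formula_subst ren_skip psi'))).
    by apply: Cand; apply: Cbex; apply: Csub => //; apply: realizable_skip.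
  move=> f s /=; rewrite (Ephi f s) (Epsi f s) /= -pair_collect.
  split=> -[b [[x xb Hx] [y yb Hy]]]; exists b.
    by split; [exists x|exists y]; rewrite ?sat_skip.
  by move: Hx Hy; rewrite !sat_skip => Hx Hy; split; [exists x|exists y].
- move=> phi psi [phi' Cphi Ephi] [psi' Cpsi Epsi].
  exists (FOr phi' psi'); first exact: Cor.
  move=> f s /=; rewrite (Ephi f s) (Epsi f s) /=.
  by split=> [[[x Hx]|[x Hx]]|[x [Hx|Hx]]];
    [exists x; left|exists x; right|left; exists x|right; exists x].
- move=> t phi [psi Cpsi E]; exists (FBEx (term_shift t) (formula_subst ren_swap psi)).
    by apply: Cbex; apply: Csub => //; apply: realizable_swap.
  move=> f s /=; split=> [[x xt /(E f (x :: s)) [y Hy]]|[y [x]]].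
    by exists y; exists x; rewrite ?term_val_shift // sat_swap.
  by rewrite term_val_shift sat_swap => xt H; exists x => //; apply/E; exists y.
- move=> t phi [psi Cpsi E].
  exists (FBAll (term_shift t) (FBEx (TVar 1) (formula_subst ren_skip2 psi))).
    by apply: Cball; apply: Cbex; apply: Csub => //; apply: realizable_skip2.
  move=> f s /=; split=> [H|[b H] x xt].
    have /bounded_collect [b Hb] : forall x, x < term_val f s t ->
      exists y, sat f (y :: x :: s) psi by move=> x /H/(E f).
    exists b => x; rewrite term_val_shift => /Hb [y yb Hy].
    by exists y => //; rewrite sat_skip2.
  have := H x; rewrite term_val_shift => /(_ xt) [y yb].
  by rewrite sat_skip2 => Hy; apply/E; exists y.
Qed.

Lemma exists_of_ex C phi : bounded_closed C -> exists_of C phi -> exists_of C (FEx phi).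
Proof.
move=> [Ceq Csub Cand Cor Cbex Cball] [psi Cpsi E].
exists (FBEx (TVar 0) (FBEx (TVar 1) (formula_subst ren_skip2 psi))).
  by apply/Cbex/Cbex; apply: Csub => //; apply: realizable_skip2.
move=> f s /=; split=> [[x /(E f) [y Hy]]|[b [x xb [y yb]]]].
  exists (x + y).+1; exists x; first by lia.
  by exists y; [lia|rewrite sat_skip2].
by rewrite sat_skip2 => Hy; exists x; apply/E; exists y.
Qed.

Lemma exists_of_sub C phi : bounded_closed C -> C phi -> exists_of C phi.
Proof.
move=> [_ Csub _ _ _ _] Cphi.
exists (formula_subst (fun i => TVar i.+1) phi); first exact: Csub realizable_shift Cphi.
move=> f s /=; split=> [H|[x]]; last by rewrite sat_shift.
by exists 0; rewrite sat_shift.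
Qed.

Lemma sigma_closed k : bounded_closed (sigma_class k).
Proof.
elim: k => [|k IHk] /=; last exact: closed_exists (closed_dual IHk).
split.
- move=> phi psi e [chi bchi E]; exists chi => // f s.
  by rewrite -(e f s); apply: E.
- move=> sigma phi r [psi bpsi E]; exists (formula_subst sigma psi).
    by rewrite bounded_subst.
  by move=> f s; have [s' e] := r f s; rewrite !(sat_subst _ e).
- move=> phi psi [phi' bphi Ephi] [psi' bpsi Epsi]; exists (FAnd phi' psi') => /=.
    by rewrite bphi.
  by move=> f s /=; rewrite (Ephi f s) (Epsi f s).
- move=> phi psi [phi' bphi Ephi] [psi' bpsi Epsi]; exists (FOr phi' psi') => /=.
    by rewrite bphi.
  by move=> f s /=; rewrite (Ephi f s) (Epsi f s).
- move=> t phi [psi bpsi E]; exists (FBEx t psi) => // f s /=.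
  by split=> -[x xt /(E f) Hx]; exists x.
- move=> t phi [psi bpsi E]; exists (FBAll t psi) => // f s /=.
  by split=> H x /H /(E f).
Qed.

Lemma pi_closed k : bounded_closed (pi_class k).
Proof. exact: closed_dual (sigma_closed k). Qed.

Lemma formula_equiv_notnot phi : formula_equiv phi (FNot (FNot phi)).
Proof. by move=> f s /=; split=> [H /(_ H)|/contrapT]. Qed.

Lemma pi_not k phi : sigma_class k phi -> pi_class k (FNot phi).
Proof. exact: closed_equiv (sigma_closed k) _ _ (formula_equiv_notnot phi). Qed.

Lemma pi_sigmaS k phi : pi_class k phi -> sigma_class k.+1 phi.
Proof. exact: exists_of_sub (pi_closed k). Qed.

Lemma sigma_piS k phi : sigma_class k phi -> pi_class k.+1 phi.
Proof. by move/pi_not/pi_sigmaS. Qed.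

Lemma sigmaS k phi : sigma_class k phi -> sigma_class k.+1 phi.
Proof.
elim: k phi => [|k IHk] phi.
  move=> [psi bpsi E]; apply: pi_sigmaS; exists (FNot psi) => // f s /=.
  by rewrite (E f s).
by case=> psi /IHk; exists psi.
Qed.

Lemma delta_sigmaS k phi : sigma_class k phi -> delta_class k.+1 phi.
Proof. by move=> H; split; [apply: sigmaS|apply: sigma_piS]. Qed.

Lemma delta_not k phi : delta_class k phi -> delta_class k (FNot phi).
Proof. by case=> S P; split=> //; apply: pi_not. Qed.

Lemma delta_closed k : bounded_closed (delta_class k).
Proof.
have [Seq Ssub Sand Sor Sbex Sball] := sigma_closed k.
have [Peq Psub Pand Por Pbex Pball] := pi_closed k.
split.
- by move=> phi psi e [S P]; split; [apply: Seq e S|apply: Peq e P].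
- by move=> sigma phi r [S P]; split; [apply: Ssub r S|apply: Psub r P].
- by move=> phi psi [S P] [S' P']; split; [apply: Sand|apply: Pand].
- by move=> phi psi [S P] [S' P']; split; [apply: Sor|apply: Por].
- by move=> t phi [S P]; split; [apply: Sbex|apply: Pbex].
- by move=> t phi [S P]; split; [apply: Sball|apply: Pball].
Qed.

Lemma delta_leq k l phi : k <= l -> delta_class k phi -> delta_class l phi.
Proof.
move=> kl; rewrite -(subnKC kl); elim: (l - k) => [|j IH]; first by rewrite addn0.
by move=> /IH []; rewrite addnS => /delta_sigmaS.
Qed.

Lemma pi_all k phi : pi_class k.+1 phi -> pi_class k.+1 (FAll phi).
Proof.
move/(exists_of_ex (pi_closed k)); apply: closed_equiv (sigma_closed k.+1) _ _ _ => f s /=.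
split=> [[x nphi] /(_ x)//|H]; apply: contrapT => nex; apply: H => x.
by apply: contrapT => nphi; apply: nex; exists x.
Qed.

Lemma bounded_delta k phi : bounded phi -> delta_class k phi.
Proof.
move=> bphi; apply: (@delta_leq 0) => //; split; first by exists phi.
by exists (FNot phi).
Qed.

Lemma sigma_class_Sigma0 k phi : sigma_class k phi ->
  (exists2 psi, Sigma0 k psi & formula_equiv phi psi) /\
  (exists2 psi, Pi0 k psi & formula_equiv (FNot phi) psi).
Proof.
elim: k phi => [|k IHk] phi.
  move=> [psi bpsi E]; split; first by exists psi => //; constructor.
  by exists (FNot psi); [constructor|move=> f s /=; rewrite (E f s)].
case=> psi /IHk [[chi Schi Echi] [chi' Pchi' Echi']] E; split.
  exists (FEx chi'); first by apply: Sigma0_Ex; apply: Sigma0_Pi0.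
  move=> f s; rewrite (E f s) /=; split=> -[x Hx]; exists x.
    by apply/Echi' => /= /(_ Hx).
  by have /Echi' /= := Hx; apply: contrapT.
exists (FAll chi); first by apply: Pi0_All; apply: Pi0_Sigma0.
move=> f s; rewrite /= (E f s) /=; split=> [H x|H [x]].
  by apply/Echi => /= Hx; apply: H; exists x.
by have /Echi /= := H x.
Qed.

Lemma delta_lightface k phi : delta_class k phi -> lightface_Delta0 k (defined_by phi).
Proof.
case=> [/sigma_class_Sigma0 [[chi Schi Echi] _] /sigma_class_Sigma0 [_ [psi Ppsi Epsi]]].
have eqd (phi' : formula) : formula_equiv phi phi' -> defined_by phi = defined_by phi'.
  move=> e; apply/funext => f; apply/propext; rewrite /defined_by /=.
  by rewrite (e f [::]).
split; first by exists chi => //; apply: eqd.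
exists psi => //; apply: eqd => f s; rewrite -(Epsi f s) /=.
by split=> [H /(_ H)|/contrapT].
Qed.

(** * Evaluation tables and the hyperjump *)

Definition power_of_two (w : nat) : Prop := exists j, w = 2 ^ j.

(** The language has no exponentiation, so powers of two are recognised by their divisors. The
    converse halves [w] repeatedly, a divisor of the half being also a divisor of [w]. *)
Lemma power_of_twoP w :
  power_of_two w <->
  0 < w /\ forall d, d < w.+1 ->
    ~ (exists2 q, q < w.+1 & d * q = w) \/ (d = 1 \/ exists2 h, h < d.+1 & d = h + h).
Proof.
split=> [[j ->]|[w0 H]].
  rewrite expn_gt0; split=> // d dw; rewrite orNp => -[q _ dq].
  have /dvdn_pfactor [//|m _ ->] : d %| 2 ^ j by rewrite -dq dvdn_mulr.
  case: m => [|m]; [by left|right; exists (2 ^ m); rewrite expnS; lia].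
have [n] := ubnP w; elim: n w w0 H => // n IHn w w0 H wn.
have [] := H w (leqnn _); first by case; exists 1; lia.
case=> [->|[h hw wh]]; first by exists 0.
have [|d dh||j hj] := IHn h; try lia.
  rewrite orNp => -[q qh dq]; have [|[]|//] := H d; first lia.
  by exists (q + q); [lia|rewrite mulnDr dq].
by exists j.+1; rewrite wh hj expnS; lia.
Qed.

(** The number of binary digits of [CodeSeq.code s]: an entry [x] contributes a one and [x]
    zeros. *)
Definition code_length (s : seq nat) : nat := size s + sumn s.

Lemma code_rcons s x :
  CodeSeq.code (rcons s x) = CodeSeq.code s + 2 ^ (code_length s + x).
Proof.
rewrite /code_length; elim: s => [|v s IHs] /=; first by rewrite muln1.
rewrite IHs.
have -> : (size s).+1 + (v + sumn s) + x = v + (size s + sumn s + x).+1 by lia.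
rewrite [2 ^ (v + _)]expnD [2 ^ _.+1]expnS; lia.
Qed.

Lemma code_lt s : CodeSeq.code s < 2 ^ code_length s.
Proof.
rewrite /code_length; elim: s => //= v s IHs.
have -> : (size s).+1 + (v + sumn s) = v + (size s + sumn s).+1 by lia.
by rewrite [2 ^ (v + _)]expnD [2 ^ _.+1]expnS ltn_pmul2l ?expn_gt0 //; lia.
Qed.

Lemma code_ge s : 2 ^ code_length s <= (CodeSeq.code s).*2.+1.
Proof.
rewrite /code_length; elim: s => //= v s IHs.
have -> : (size s).+1 + (v + sumn s) = v + (size s + sumn s).+1 by lia.
rewrite [2 ^ (v + _)]expnD [2 ^ _.+1]expnS; nia.
Qed.

(** Appending an entry to a sequence adds a new leading bit to its code. *)
Lemma code_rconsP s t :
  (exists x, t = CodeSeq.code (rcons s x)) <->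
  exists w, [/\ power_of_two w, CodeSeq.code s < w & t = CodeSeq.code s + w].
Proof.
split=> [[x ->]|[_ [[j ->] sw ->]]].
  exists (2 ^ (code_length s + x)); split; [by eexists| |exact: code_rcons].
  by apply: leq_trans (code_lt s) _; rewrite leq_exp2l ?leq_addr.
exists (j - code_length s); rewrite code_rcons subnKC //.
have : 2 ^ code_length s < 2 ^ j.+1 by have := code_ge s; rewrite expnS; lia.
by rewrite ltn_exp2l.
Qed.

(** [1] when the program diverges, and [y + 2] when it returns [y]. *)
Definition eval_result (X : set nat) (c : code) (n : nat) : nat :=
  if pselect (exists y, eval X c n y) is left H then (projT1 (cid H)).+2 else 1.

Variant eval_result_spec X c n : nat -> Prop :=
| EvalHalts y of eval X c n y : eval_result_spec X c n y.+2
| EvalDiverges of (forall y, ~ eval X c n y) : eval_result_spec X c n 1.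

Lemma eval_resultP X c n : eval_result_spec X c n (eval_result X c n).
Proof.
rewrite /eval_result; case: pselect => [H|H]; last first.
  by constructor => y Hy; apply: H; exists y.
by case: cid => y Hy /=; constructor.
Qed.

Lemma eval_result_halts X c n y : eval_result X c n = y.+2 <-> eval X c n y.
Proof.
case: eval_resultP => [z Hz|H]; last by split=> // /H.
by split=> [[<-]//|/(eval_det Hz) ->].
Qed.

Lemma eval_result_diverges X c n :
  eval_result X c n = 1 <-> forall y, ~ eval X c n y.
Proof. by case: eval_resultP => [z Hz|H]; split=> // /(_ _ Hz). Qed.

Lemma eval_result_neq0 X c n : eval_result X c n <> 0.
Proof. by case: eval_resultP. Qed.

Definition code_extension (a t : nat) : Prop :=
  exists2 w, w < t.+1 & [/\ power_of_two w, a < w & t = a + w].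

Lemma code_extensionP a t :
  code_extension a t <-> exists x, CodeSeq.decode t = rcons (CodeSeq.decode a) x.
Proof.
transitivity (exists x, t = CodeSeq.code (rcons (CodeSeq.decode a) x)).
  rewrite code_rconsP CodeSeq.decodeK.
  by split=> [[w _ H]|[w H]]; exists w => //; case: H => _ _ ->; lia.
by split=> -[x e]; exists x; rewrite -?e ?CodeSeq.decodeK // e CodeSeq.codeK.
Qed.

Lemma is_treeP T : is_tree T <-> forall s x, T (rcons s x) -> T s.
Proof.
split=> [H s x|H s t]; first by rewrite -cats1; apply: H.
elim/last_ind: t => [|t x IH]; first by rewrite cats0.
by rewrite -rcons_cat => /H.
Qed.

(** A path enters as the sequence [q] of the codes of its initial segments, so that each condition
    looks at finitely many values of [r]. The values 2 and 3 stand for the outputs 0 and 1. *)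
Lemma hyperjump_gnum X c (r := eval_result X c) :
  hyperjump X (gnum c) <->
  [/\ forall n, r n = 2 \/ r n = 3,
      forall a t, code_extension a t -> r t = 3 -> r a = 3
    & ~ exists q : nat -> nat,
        q 0 = 0 /\ forall k, r (q k) = 3 /\ code_extension (q k) (q k.+1)].
Proof.
split=> [[c' [T [treeT cT npath]] /gnum_inj e]|[tot tree npath]].
  move: cT; rewrite {}e => cT.
  have Tr s : T s <-> r (CodeSeq.code s) = 3.
    rewrite eval_result_halts; split=> [Ts|H].
      by apply: (cT _).1; exists s.
    apply: contrapT => nTs; have /(cT _).2 : ~ (CodeSeq.code @` T) (CodeSeq.code s).
      by move=> [s' Ts' /(can_inj CodeSeq.codeK) e]; apply: nTs; rewrite -e.
    by move/(eval_det H).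
  split=> [n|a t /code_extensionP[x e]|[q [q0 qS]]].
  - have [Tn|Tn] := pselect ((CodeSeq.code @` T) n).
      by right; apply/eval_result_halts/(cT n).1.
    by left; apply/eval_result_halts/(cT n).2.
  - rewrite -(CodeSeq.decodeK t) -(CodeSeq.decodeK a) -!Tr e.
    by apply: (is_treeP T).1.
  (* Node [q k.+1] extends [q k] by one entry, so its last entry is the value of the path at [k]. *)
  - apply: npath; exists (fun k => last 0 (CodeSeq.decode (q k.+1))) => k.
    suff -> : mkseq (fun k => last 0 (CodeSeq.decode (q k.+1))) k = CodeSeq.decode (q k).
      by rewrite Tr CodeSeq.decodeK; have [] := qS k.
    elim: k => [|k IHk]; first by rewrite q0.
    have [_ /code_extensionP[x e]] := qS k.
    by rewrite mkseqS IHk e last_rcons.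
exists c => //; exists [set s | r (CodeSeq.code s) = 3]; split.
- apply/is_treeP => s x; apply: tree; apply/code_extensionP; exists x.
  by rewrite !CodeSeq.codeK.
- move=> n; split=> [[s rs <-]|nT]; first exact/eval_result_halts.
  have [/eval_result_halts//|rn] := tot n; case: nT; exists (CodeSeq.decode n).
    by rewrite /= CodeSeq.decodeK.
  exact: CodeSeq.decodeK.
- move=> [p Hp]; apply: npath; exists (fun k => CodeSeq.code (mkseq p k)).
  split=> // k; split; first exact: Hp.
  by apply/code_extensionP; exists (p k); rewrite !CodeSeq.codeK mkseqS.
Qed.

Lemma hyperjump_is_gnum X x : hyperjump X x -> exists c, x = gnum c.
Proof. by move=> [c _ <-]; exists c. Qed.

(** Constraints which force [E (gnum c) n] to be [eval_result X c n], given the answers of the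
    oracle.  The value [0] stands for a number indexing no program: the premises [E a 0 <> 0]
    make room for such numbers, for which nothing is required. *)
Record valid_table (E : nat -> nat -> nat) : Prop := ValidTable {
  valid_const : forall k n, E (cpair 0 k) n = k.+2;
  valid_succ : forall n, E (cpair 1 0) n = n.+3;
  valid_fst : forall u v, E (cpair 2 0) (cpair u v) = u.+2;
  valid_snd : forall u v, E (cpair 3 0) (cpair u v) = v.+2;
  valid_pair : forall a b n (c := cpair 5 (cpair a b)), E a 0 <> 0 -> E b 0 <> 0 ->
    [/\ E a n = 1 -> E c n = 1, E b n = 1 -> E c n = 1
      & forall u v, E a n = u.+2 -> E b n = v.+2 -> E c n = (cpair u v).+2];
  valid_comp : forall a b n (c := cpair 6 (cpair a b)), E a 0 <> 0 -> E b 0 <> 0 ->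
    (E b n = 1 -> E c n = 1) /\ (forall u, E b n = u.+2 -> E c n = E a u);
  valid_prec : forall a b x (c := cpair 7 (cpair a b)), E a 0 <> 0 -> E b 0 <> 0 ->
    E c (cpair x 0) = E a x /\
    forall k, (E c (cpair x k) = 1 -> E c (cpair x k.+1) = 1) /\
      forall y, E c (cpair x k) = y.+2 ->
        E c (cpair x k.+1) = E b (cpair x (cpair k y));
  valid_mu : forall a n (c := cpair 8 a), E a 0 <> 0 ->
    [/\ E c n <> 0,
        forall y, E c n = y.+2 ->
          E a (cpair n y) = 2 /\
          forall i, i < y -> E a (cpair n i) <> 2 /\ E a (cpair n i) <> 1
      & E c n = 1 -> forall y,
          E a (cpair n y) <> 2 \/ exists2 i, i < y & E a (cpair n i) = 1] }.

Lemma eval_result_pair X c d n (r := eval_result X) :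
  [/\ r c n = 1 -> r (CPair c d) n = 1, r d n = 1 -> r (CPair c d) n = 1
    & forall u v, r c n = u.+2 -> r d n = v.+2 -> r (CPair c d) n = (cpair u v).+2].
Proof.
split=> [||u v].
- by rewrite !eval_result_diverges => H y [a [b [/H]]].
- by rewrite !eval_result_diverges => H y [a [b [_ /H]]].
- by move=> /eval_result_halts cu /eval_result_halts dv; apply/eval_result_halts; exists u, v.
Qed.

Lemma eval_result_comp X c d n (r := eval_result X) :
  (r d n = 1 -> r (CComp c d) n = 1) /\
  (forall u, r d n = u.+2 -> r (CComp c d) n = r c u).
Proof.
split=> [|u /eval_result_halts du].
  by rewrite !eval_result_diverges => H y [a /H].
rewrite /r; case: (eval_resultP X c u) => [y cy|H].
  by apply/eval_result_halts; exists u.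
by apply/eval_result_diverges => y [a /(eval_det du)<- /H].
Qed.

Lemma eval_result_prec X c d x (r := eval_result X) (e := r (CPrec c d)) :
  e (cpair x 0) = r c x /\
  forall k, (e (cpair x k) = 1 -> e (cpair x k.+1) = 1) /\
    forall y, e (cpair x k) = y.+2 -> e (cpair x k.+1) = r d (cpair x (cpair k y)).
Proof.
have evalS k y : eval X (CPrec c d) (cpair x k.+1) y <->
    exists2 z, eval X (CPrec c d) (cpair x k) z & eval X d (cpair x (cpair k z)) y.
  by rewrite /= !cpairE.
rewrite /e /r; split=> [|k].
  case: (eval_resultP X c x) => [y cy|H].
    by apply/eval_result_halts => /=; rewrite !cpairE.
  by apply/eval_result_diverges => y /=; rewrite !cpairE; apply: H.
split=> [|y /eval_result_halts Hy].
  by rewrite !eval_result_diverges => H y /evalS[z /H].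
case: (eval_resultP X d _) => [z dz|H].
  by apply/eval_result_halts/evalS; exists y.
by apply/eval_result_diverges => z /evalS[y' /(eval_det Hy)<- /H].
Qed.

Lemma eval_result_mu X c n (r := eval_result X) :
  [/\ r (CMu c) n <> 0,
      forall y, r (CMu c) n = y.+2 ->
        r c (cpair n y) = 2 /\
        forall i, i < y -> r c (cpair n i) <> 2 /\ r c (cpair n i) <> 1
    & r (CMu c) n = 1 -> forall y,
        r c (cpair n y) <> 2 \/ exists2 i, i < y & r c (cpair n i) = 1].
Proof.
rewrite /r; split=> [|y /eval_result_halts[c0 cpos]|]; first exact: eval_result_neq0.
  split=> [|i /cpos [z /eval_result_halts ->]//]; first exact/eval_result_halts.
move=> /eval_result_diverges H y; apply: contrapT => /not_orP[/contrapT cy nex].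
have exy : exists y, eval_result X c (cpair n y) == 2 by exists y; rewrite cy.
case: (ex_minnP exy) => m /eqP cm mmin; apply: (H m); split; first exact/eval_result_halts.
move=> i im; case E : (eval_result X c (cpair n i)) => [|[|[|z]]].
- by case: (eval_result_neq0 E).
- by case: nex; exists i => //; have := mmin y; rewrite cy => /(_ isT); lia.
- by have := mmin i; rewrite E => /(_ isT); lia.
- by exists z; apply/eval_result_halts.
Qed.

(** Induction on the program: the row of a composite program is determined by the rows of its parts.
    Recording divergence as the value 1 extends this to partial programs; for minimization the
    constraints exclude both a false divergence and a wrong least zero. *)
Lemma valid_table_unique X E : valid_table E ->
  (forall n, E (cpair 4 0) n = (`[< X n >] : nat).+2) ->
  forall c n, E (gnum c) n = eval_result X c n.
Proof.
move=> [Vk Vs Vf Vn Vp Vc Vr Vm] EX.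
elim=> [k|||||c IHc d IHd|c IHc d IHd|c IHc d IHd|c IHc] n /=.
- by rewrite Vk; apply/esym/eval_result_halts.
- by rewrite Vs; apply/esym/eval_result_halts.
- by rewrite -(cpairK n) Vf; apply/esym/eval_result_halts; rewrite /= cpairE.
- by rewrite -(cpairK n) Vn; apply/esym/eval_result_halts; rewrite /= cpairE.
- rewrite EX; apply/esym/eval_result_halts => /=.
  by case: asboolP; [left|right].
(* Rows of actual programs never take the value 0, so the premises of the constraints are met. *)
all: try have c0 : E (gnum c) 0 <> 0 by rewrite IHc; apply: eval_result_neq0.
all: try have d0 : E (gnum d) 0 <> 0 by rewrite IHd; apply: eval_result_neq0.
- have [] := Vp _ _ n c0 d0; have [] := eval_result_pair X c d n; rewrite IHc IHd.
  case: (eval_result X c n) (@eval_result_neq0 X c n) => [//|[|u]] _.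
    by move=> -> // _ _ -> .
  case: (eval_result X d n) (@eval_result_neq0 X d n) => [//|[|v]] _.
    by move=> _ -> // _ _ ->.
  by move=> _ _ /(_ u v) -> // _ _ /(_ u v) ->.
- have [] := Vc _ _ n c0 d0; have [] := eval_result_comp X c d n; rewrite IHd.
  case: (eval_result X d n) (@eval_result_neq0 X d n) => [//|[|u]] _.
    by move=> -> // _ ->.
  by move=> _ /(_ u) -> // _ /(_ u) ->.
- rewrite -(cpairK n); move: (pfst n) (psnd n) => x k.
  have [e0 eS] := Vr _ _ x c0 d0; have [r0 rS] := eval_result_prec X c d x.
  elim: k => [|k IHk]; first by rewrite e0 r0.
  have [e1 e2] := eS k; have [r1 r2] := rS k.
  case E1 : (eval_result X (CPrec c d) (cpair x k)) => [|[|y]].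
  - by case: (eval_result_neq0 E1).
  - by rewrite e1 ?r1 // IHk.
  - by rewrite (e2 y) ?(r2 y) ?IHd // IHk.
- have [E0 E2 E1] := Vm _ n c0; have [_ r2 r1] := eval_result_mu X c n.
  case E3 : (E (cpair 8 (gnum c)) n) => [|[|y]] //.
    have {}E1 := E1 E3; case r3 : (eval_result X (CMu c) n) => [|[|z]] //.
      by case: (eval_result_neq0 r3).
    have [rz ri] := r2 _ r3; case: (E1 z); first by rewrite IHc rz.
    by case=> i /ri []; rewrite IHc.
  have [Ey Ei] := E2 _ E3; case r3 : (eval_result X (CMu c) n) => [|[|z]].
  - by case: (eval_result_neq0 r3).
  - have [] := r1 r3 y; first by rewrite -IHc Ey.
    by case=> i /Ei []; rewrite IHc.
  - have [rz ri] := r2 _ r3; case: (ltngtP y z) => [/ri[]|/Ei[]|->//].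
      by rewrite -IHc Ey.
    by rewrite IHc rz.
Qed.

Definition eval_table (X : set nat) (x n : nat) : nat :=
  if pselect (exists c, gnum c = x) is left H then eval_result X (projT1 (cid H)) n else 0.

Lemma eval_table_gnum X c n : eval_table X (gnum c) n = eval_result X c n.
Proof.
rewrite /eval_table; case: pselect => [H|[]]; last by exists c.
by case: cid => d /= /gnum_inj ->.
Qed.

Lemma eval_table_neq0 X x n : eval_table X x n <> 0 -> exists c, x = gnum c.
Proof. by rewrite /eval_table; case: pselect => // -[c e] _; exists c. Qed.

Lemma eval_table_valid X : valid_table (eval_table X).
Proof.
split=> [k n|n|u v|u v|a b n c|a b n c|a b x c|a n c].
- by rewrite (eval_table_gnum X (CConst k)); apply/eval_result_halts.
- by rewrite (eval_table_gnum X CSucc); apply/eval_result_halts.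
- by rewrite (eval_table_gnum X CFst); apply/eval_result_halts; rewrite /= cpairE.
- by rewrite (eval_table_gnum X CSnd); apply/eval_result_halts; rewrite /= cpairE.
- move=> /eval_table_neq0[c' e] /eval_table_neq0[d' e']; rewrite /c e e'.
  rewrite !(eval_table_gnum X (CPair c' d')) !eval_table_gnum.
  exact: eval_result_pair.
- move=> /eval_table_neq0[c' e] /eval_table_neq0[d' e']; rewrite /c e e'.
  have [H1 H2] := eval_result_comp X c' d' n.
  rewrite !(eval_table_gnum X (CComp c' d')) !eval_table_gnum; split=> // u.
  by rewrite eval_table_gnum => /H2.
- move=> /eval_table_neq0[c' e] /eval_table_neq0[d' e']; rewrite /c e e'.
  have [H1 H2] := eval_result_prec X c' d' x.
  rewrite !(eval_table_gnum X (CPrec c' d')) !eval_table_gnum; split=> // k.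
  rewrite !(eval_table_gnum X (CPrec c' d')); have [H3 H4] := H2 k; split=> // y.
  by rewrite eval_table_gnum => /H4.
- move=> /eval_table_neq0[c' e]; rewrite /c e.
  have [H1 H2 H3] := eval_result_mu X c' n.
  rewrite !(eval_table_gnum X (CMu c')); split=> // [y /H2|/H3 H y].
    by rewrite eval_table_gnum => -[? Hi]; split=> // i /Hi; rewrite eval_table_gnum.
  rewrite eval_table_gnum; have [|[i iy Hi]] := H y; [by left|right; exists i => //].
  by rewrite eval_table_gnum.
Qed.

Lemma eval_table_oracle X n : eval_table X (cpair 4 0) n = (`[< X n >] : nat).+2.
Proof.
rewrite (eval_table_gnum X COracle); apply/eval_result_halts => /=.
by case: asboolP; [left|right].
Qed.

(** The sequence [q] shows that [x] is not in the hyperjump, according to the table [E]: either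
    program [x] is not total with values in [{0, 1}] (at [q 0]), or it is not the characteristic
    function of a tree (at [q 0] and its extension [q 1]), or [q] is a path. *)
Definition hyperjump_refutation (E : nat -> nat -> nat) (q : nat -> nat) (x : nat) : Prop :=
  [\/ E x (q 0) <> 2 /\ E x (q 0) <> 3,
      code_extension (q 0) (q 1) /\ (E x (q 1) = 3 /\ E x (q 0) <> 3)
    | q 0 = 0 /\ forall i, E x (q i) = 3 /\ code_extension (q i) (q i.+1)].

(** Forwards, the true table serves as [E]; backwards, uniqueness identifies any valid [E] having
    the right oracle row with the true table on all programs. *)
Lemma hyperjumpPn X x :
  ~ hyperjump X x <->
  exists E q, [/\ valid_table E, forall n, E (cpair 4 0) n = (`[< X n >] : nat).+2
                & hyperjump_refutation E q x].
Proof.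
split=> [nHJ|[E [q [V EX R]] HJ]].
  suff [q R] : exists q, hyperjump_refutation (eval_table X) q x.
    exists (eval_table X), q; split=> //; first exact: eval_table_valid.
    exact: eval_table_oracle.
  have [[c e]|ngnum] := pselect (exists c, gnum c = x); last first.
    (* If [x] indexes no program, its row is constantly 0, which is neither 2 nor 3, so any sequence
       will do. *)
    exists id; constructor 1; rewrite /eval_table; case: pselect => //.
  move: nHJ; rewrite -{x}e => nHJ.
  apply: contrapT => nR; apply: nHJ; apply/hyperjump_gnum; split.
  - move=> n; apply: contrapT => /not_orP H; apply: nR; exists (fun=> n).
    by constructor 1; rewrite eval_table_gnum.
  - move=> a t ext rt; apply: contrapT => ra; apply: nR.
    by exists (fun k => if k is 0 then a else t); constructor 2; rewrite !eval_table_gnum.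
  - move=> [q [q0 Hq]]; apply: nR; exists q; constructor 3; split=> // i.
    by rewrite eval_table_gnum.
have [c e] := hyperjump_is_gnum HJ; move: HJ R; rewrite e => /hyperjump_gnum[tot tree npath].
rewrite /hyperjump_refutation !(valid_table_unique V EX); case.
- by case=> n2 n3; case: (tot (q 0)).
- by case=> ext [q1]; apply; apply: tree ext q1.
- move=> [q0 Hq]; apply: npath; exists q; split=> // k; have := Hq k.
  by rewrite (valid_table_unique V EX).
Qed.

(** * Coding of finite sequences and compactness *)

(** Goedel's beta function, by which two numbers code a finite sequence. *)
Definition beta (a b i : nat) : nat := a %% (i.+1 * b).+1.

Lemma beta_surj (p : nat -> nat) L : exists a b, forall i, i < L -> beta a b i = p i.
Proof.
(* The factorial makes the moduli [m i] pairwise coprime, and the sum makes each of them larger than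
   the value to be coded, so the Chinese remainder theorem applies. *)
pose b := L`! * (\sum_(i < L) p i).+1; pose m i := (i.+1 * b).+1.
have cop i j : i < j -> j < L -> coprime (m i) (m j).
  move=> ij jL; set g := gcdn (m i) (m j).
  have gi : g %| m i by apply: dvdn_gcdl.
  have cgb : coprime g b.
    apply: coprime_dvdl gi _; rewrite /m -addn1 /coprime gcdnC.
    by rewrite gcdnMDl gcdn1.
  have : g %| (j - i) * b.
    have := dvdn_gcdr (m i) (m j); rewrite -/g.
    have -> : m j = (j - i) * b + m i.
      by rewrite /m addnS; congr _.+1; rewrite -mulnDl addnS subnK // ltnW.
    by rewrite dvdn_addl.
  rewrite Gauss_dvdl // => gji.
  have gb : g %| b.
    apply: dvdn_trans gji _; apply: dvdn_mulr; apply: dvdn_fact; lia.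
  by rewrite /coprime -/g; have := gcdn_idPl gb; rewrite (eqP cgb) => <-.
suff [a Ha] : exists a, forall i, i < L -> a = p i %[mod m i].
  exists a, b => i iL; rewrite /beta -/(m i) (Ha i iL) modn_small //.
  rewrite /m ltnS /b.
  have : p i <= \sum_(i < L) p i by rewrite (bigD1 (Ordinal iL)) //= leq_addr.
  have := fact_gt0 L; nia.
have H : forall L', L' <= L -> exists a, forall i, i < L' -> a = p i %[mod m i].
  elim=> [|L' IH] L'L; first by exists 0.
  have [a Ha] := IH (ltnW L'L).
  have cp : coprime (\prod_(i < L') m i) (m L').
    elim/big_ind: _ => [|x y cx cy|i _]; first exact: coprime1n.
      by rewrite coprimeMl cx.
    exact: cop.
  exists (chinese (\prod_(i < L') m i) (m L') a (p L')) => i.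
  rewrite ltnS leq_eqVlt => /orP[/eqP->|iL']; first exact: chinese_modr.
  have dv : m i %| \prod_(i < L') m i by rewrite (bigD1 (Ordinal iL')) //= dvdn_mulr.
  by rewrite -(modn_dvdm _ dv) chinese_modl // modn_dvdm // Ha.
exact: H.
Qed.

Definition beta_graph (a b i v : term) : formula :=
  let m := TSucc (TMul (TSucc (term_shift i)) (term_shift b)) in
  FBEx (TSucc a)
    (FAnd (FEq (term_shift a) (TAdd (TMul (TVar 0) m) (term_shift v)))
          (FLt (term_shift v) m)).

Lemma sat_beta_graph f s a b i v :
  sat f s (beta_graph a b i v) <->
  beta (term_val f s a) (term_val f s b) (term_val f s i) = term_val f s v.
Proof.
rewrite /beta_graph /beta /=; split.
  by move=> [q _ []]; rewrite !term_val_shift => -> lt; rewrite modnMDl modn_small.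
set m := (_ * _).+1 => e; exists (term_val f s a %/ m); first by rewrite ltnS leq_div.
by rewrite !term_val_shift -/m -e -divn_eq; split=> //; rewrite ltn_mod.
Qed.

Fixpoint app_free (t : term) : bool :=
  match t with
  | TVar _ | TZero => true
  | TSucc t => app_free t
  | TAdd t u | TMul t u => app_free t && app_free u
  | TApp _ => false
  end.

Lemma app_free_val t f g s : app_free t -> term_val f s t = term_val g s t.
Proof.
by elim: t => //= [t IH /IH->|t IHt u IHu /andP[/IHt-> /IHu->]|t IHt u IHu /andP[/IHt-> /IHu->]].
Qed.

(** Bounded formulas where [TApp] occurs only in atoms [f(t) = u], with [t] and [u] pure. *)
Fixpoint flat (phi : formula) : bool :=
  match phi with
  | FEq (TApp t) u => app_free t && app_free u
  | FEq t u | FLt t u => app_free t && app_free u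
  | FNot phi => flat phi
  | FAnd phi psi | FOr phi psi => flat phi && flat psi
  | FBEx t phi | FBAll t phi => app_free t && flat phi
  | FEx _ | FAll _ => false
  end.

(** Makes a flat formula speak about the function coded by the number variables [a] and [b]; the
    function variable is thereby freed for the given infinite set. *)
Fixpoint beta_formula (a b : nat) (phi : formula) : formula :=
  match phi with
  | FEq (TApp t) u => beta_graph (TVar a) (TVar b) t u
  | FEq _ _ | FLt _ _ => phi
  | FNot phi => FNot (beta_formula a b phi)
  | FAnd phi psi => FAnd (beta_formula a b phi) (beta_formula a b psi)
  | FOr phi psi => FOr (beta_formula a b phi) (beta_formula a b psi)
  | FBEx t phi => FBEx t (beta_formula a.+1 b.+1 phi)
  | FBAll t phi => FBAll t (beta_formula a.+1 b.+1 phi)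
  | FEx phi => FEx (beta_formula a.+1 b.+1 phi)
  | FAll phi => FAll (beta_formula a.+1 b.+1 phi)
  end.

Lemma sat_beta_formula f a b phi s : flat phi ->
  sat f s (beta_formula a b phi) <-> sat (beta (nth 0 s a) (nth 0 s b)) s phi.
Proof.
elim: phi a b s => [t u|t u|phi IH|phi IHp psi IHq|phi IHp psi IHq|
  t phi IH|t phi IH|phi IH|phi IH] a b s /=.
- set p := beta _ _.
  have pure t' : app_free t' && app_free u ->
      term_val f s t' = term_val f s u <-> term_val p s t' = term_val p s u.
    by case/andP=> ft fu; rewrite (app_free_val f p s ft) (app_free_val f p s fu).
  case: t => [i||t|t t'|t t'|t]; try exact: pure.
  case/andP=> ft fu; change (sat f s (beta_graph (TVar a) (TVar b) t u) <->
    p (term_val p s t) = term_val p s u).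
  by rewrite sat_beta_graph /= (app_free_val f p s ft) (app_free_val f p s fu).
- case/andP=> ft fu; set p := beta _ _.
  by rewrite (app_free_val f p s ft) (app_free_val f p s fu).
- by move=> /IH ->.
- by case/andP=> /IHp-> /IHq->.
- by case/andP=> /IHp-> /IHq->.
- case/andP=> ft fphi; set p := beta _ _; rewrite (app_free_val f p s ft).
  by split=> -[y yt Hy]; exists y => //; move: Hy; rewrite (IH _ _ _ fphi).
- case/andP=> ft fphi; set p := beta _ _; rewrite (app_free_val f p s ft).
  by split=> H y /H; rewrite (IH _ _ _ fphi).
- by [].
- by [].
Qed.

Lemma bounded_beta_formula a b phi : bounded phi -> bounded (beta_formula a b phi).
Proof.
elim: phi a b => [t u|t u|phi IH|phi IHp psi IHq|phi IHp psi IHq|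
  t phi IH|t phi IH|//|//] a b;
  first by case: t.
all: first [by move=> /=; apply: IH | by move=> /= /andP[/IHp-> /IHq->] | done].
Qed.

(** Evaluating a bounded formula consults only finitely many values of [p]; at a bounded quantifier,
    collection gives one modulus for all instances. *)
Lemma bounded_continuous phi (p : nat -> nat) s : bounded phi ->
  exists N, forall p', (forall i, i < N -> p' i = p i) -> sat p' s phi <-> sat p s phi.
Proof.
have tm t s' : exists N, forall p', (forall i, i < N -> p' i = p i) ->
    term_val p' s' t = term_val p s' t.
  elim: t => [i||t [N IH]|t [N IHt] u [M IHu]|t [N IHt] u [M IHu]|t [N IH]] /=.
  - by exists 0.
  - by exists 0.
  - by exists N => p' /IH ->.
  - exists (N + M) => p' pp; rewrite IHt ?IHu // => i iM; apply: pp; lia.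
  - exists (N + M) => p' pp; rewrite IHt ?IHu // => i iM; apply: pp; lia.
  - exists (N + (term_val p s' t).+1) => p' pp; rewrite IH; first by apply: pp; lia.
    by move=> i iN; apply: pp; lia.
have bq t phi' s' :
    (forall s, exists N, forall p', (forall i, i < N -> p' i = p i) ->
      sat p' s phi' <-> sat p s phi') ->
    exists N, forall p', (forall i, i < N -> p' i = p i) ->
      term_val p' s' t = term_val p s' t /\
      forall x, x < term_val p s' t -> sat p' (x :: s') phi' <-> sat p (x :: s') phi'.
  move=> IH; have [M HM] := tm t s'.
  have [|b Hb] := @bounded_collect (term_val p s' t) (fun x N =>
    forall p', (forall i, i < N -> p' i = p i) ->
      sat p' (x :: s') phi' <-> sat p (x :: s') phi').
    by move=> x _; apply: IH.
  exists (b + M) => p' pp; split=> [|x /Hb[N Nb]].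
    by apply: HM => i iM; apply: pp; lia.
  by apply=> i iN; apply: pp; lia.
elim: phi s => [t u|t u|phi IH|phi IHp psi IHq|phi IHp psi IHq|
  t phi IH|t phi IH|phi IH|phi IH] s //=.
- move=> _; have [N Ht] := tm t s; have [M Hu] := tm u s; exists (N + M) => p' pp.
  by rewrite Ht ?Hu // => i iN; apply: pp; lia.
- move=> _; have [N Ht] := tm t s; have [M Hu] := tm u s; exists (N + M) => p' pp.
  by rewrite Ht ?Hu // => i iN; apply: pp; lia.
- by move=> /(IH s)[N HN]; exists N => p' /HN ->.
- case/andP=> /(IHp s)[N Ht] /(IHq s)[M Hu]; exists (N + M) => p' pp.
  by rewrite Ht ?Hu // => i iN; apply: pp; lia.
- case/andP=> /(IHp s)[N Ht] /(IHq s)[M Hu]; exists (N + M) => p' pp.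
  by rewrite Ht ?Hu // => i iN; apply: pp; lia.
- move=> bphi; have [N HN] := bq t phi s (fun s' => IH s' bphi).
  exists N => p' /HN[-> H].
  by split=> -[x xt Hx]; exists x => //; apply/(H x xt).
- move=> bphi; have [N HN] := bq t phi s (fun s' => IH s' bphi).
  exists N => p' /HN[-> H].
  by split=> H' x xt; apply/(H x xt); apply: H'.
Qed.

(** A Koenig argument: the finite sequences that agree with arbitrarily late [P k] form a tree
    without dead ends, and [p] is a branch through it. *)
Lemma compactness (P : nat -> nat -> nat) (h : nat -> nat) :
  (forall k i, i < k -> P k i <= h i) ->
  exists p : nat -> nat, forall N K, exists2 k, K <= k & forall i, i < N -> P k i = p i.
Proof.
move=> Ph.
pose often (s : seq nat) :=
  forall K, exists2 k, K <= k & forall i, i < size s -> P k i = nth 0 s i.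
have often_rcons s : often s -> exists v, often (rcons s v).
  (* Were there no next value, each of the finitely many candidates up to [h (size s)] would fail
     beyond some bound, against a [k] past all these bounds. *)
  move=> os; apply: contrapT => nex.
  have /bounded_collect [B HB] : forall v, v < (h (size s)).+1 -> exists K, forall k, K <= k ->
      ~ forall i, i < size (rcons s v) -> P k i = nth 0 (rcons s v) i.
    move=> v _; apply: contrapT => nK; apply: nex; exists v => K.
    apply: contrapT => nk; apply: nK; exists K => k Kk H; apply: nk.
    by exists k.
  have [k kB Hk] := os (B + (size s).+1).
  have Pk : P k (size s) < (h (size s)).+1 by rewrite ltnS; apply: Ph; lia.
  have [K KB /(_ k)] := HB _ Pk; apply; first by lia.
  move=> i; rewrite size_rcons nth_rcons ltnS leq_eqVlt => /orP[/eqP->|iS].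
    by rewrite ltnn eqxx.
  by rewrite iS Hk.
have [step Hstep] : exists step, forall s, often s -> often (rcons s (step s)).
  have /choice : forall s, exists v, often s -> often (rcons s v).
    move=> s; have [/often_rcons[v Hv]|no] := pselect (often s); first by exists v.
    by exists 0.
  by case=> step; exists step.
pose S := fix S n := if n is n'.+1 then rcons (S n') (step (S n')) else [::].
have SE n : S n.+1 = rcons (S n) (step (S n)) by [].
have sizeS n : size (S n) = n by elim: n => // n IH; rewrite SE size_rcons IH.
have oS n : often (S n).
  elim: n => [K|n /Hstep]; first by exists K.
  by rewrite SE.
exists (fun i => step (S i)) => N K; have [k Kk Hk] := oS N K; exists k => // i iN.
rewrite Hk ?sizeS //; elim: N iN {Hk} => // N IH.
rewrite ltnS SE nth_rcons sizeS leq_eqVlt => /orP[/eqP->|iN].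
  by rewrite ltnn eqxx.
by rewrite iN IH.
Qed.

(** * The stages as a bounded formula *)

(** A function [p] codes the pair [(E, q)] with [E c n = p (2 <c, n>)] and [q i = p (2 i + 1)];
    doubling makes Cantor's pairing a polynomial. *)
Definition double_pair (c n : nat) : nat := (c + n) * (c + n).+1 + n + n.
Definition table_of (p : nat -> nat) (c n : nat) : nat := p (double_pair c n).
Definition sequence_of (p : nat -> nat) (i : nat) : nat := p (i + i).+1.

Lemma double_pairE c n : double_pair c n = cpair c n + cpair c n.
Proof. by rewrite cpair_double. Qed.

Lemma double_pair_eq d a b : d + d = double_pair a b <-> d = cpair a b.
Proof. rewrite double_pairE; split; lia. Qed.

Notation v0 := (TVar 0).
Notation v1 := (TVar 1).
Notation v2 := (TVar 2).
Notation v3 := (TVar 3).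
Notation v4 := (TVar 4).
Notation v5 := (TVar 5).
Notation v6 := (TVar 6).
Notation v7 := (TVar 7).
Notation v8 := (TVar 8).

Definition tnum (n : nat) : term := iter n TSucc TZero.
Definition tpair2 (c n : term) : term :=
  TAdd (TAdd (TMul (TAdd c n) (TSucc (TAdd c n))) n) n.
Definition fentry (c n v : term) : formula := FEq (TApp (tpair2 c n)) v.
Definition fseq (i v : term) : formula := FEq (TApp (TSucc (TAdd i i))) v.
Definition fpair (a b d : term) : formula := FEq (TAdd d d) (tpair2 a b).
Definition fprogram (c : term) : formula := FNot (fentry c TZero TZero).
Definition fimp (phi psi : formula) : formula := FOr (FNot phi) psi.

(** [r] universal quantifiers, all bounded by the variable [i] *)
Fixpoint fball (i r : nat) (phi : formula) : formula :=
  if r is r'.+1 then FBAll (TVar i) (fball i.+1 r' phi) else phi.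

Definition fpower_of_two (w : nat) : formula :=
  FAnd (FLt TZero (TVar w))
    (FBAll (TSucc (TVar w))
      (FOr (FNot (FBEx (TSucc (TVar w.+1)) (FEq (TMul v1 v0) (TVar w.+2))))
        (FOr (FEq v0 (tnum 1)) (FBEx (TSucc v0) (FEq v1 (TAdd v0 v0)))))).

Definition fextension (a t : nat) : formula :=
  FBEx (TSucc (TVar t)) (FAnd (fpower_of_two 0)
    (FAnd (FLt (TVar a.+1) v0) (FEq (TVar t.+1) (TAdd (TVar a.+1) v0)))).

Lemma sat_extension p s a t :
  sat p s (fextension a t) <-> code_extension (nth 0 s a) (nth 0 s t).
Proof.
split=> -[w wt] /=.
  by rewrite -power_of_twoP => -[pw [aw e]]; exists w.
by move=> [pw aw e]; exists w => //=; rewrite -power_of_twoP.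
Qed.

(** Each clause is a constraint whose universal quantifiers are bounded by the stage, so that all
    stages together give the full constraint. Pairs and table values get variables of their own,
    which keeps the formula flat. *)
Definition clause_const : formula := fball 0 3
  (fimp (fpair TZero v2 v1) (fentry v1 v0 (TSucc (TSucc v2)))).

(** The numerals 1, 3, 6 and 10 used as programs here and below are the triangular numbers
    [cpair t 0] for [t] from 1 to 4. *)
Definition clause_succ : formula := fball 0 1
  (fentry (tnum 1) v0 (TSucc (TSucc (TSucc v0)))).

Definition clause_proj : formula := fball 0 3
  (fimp (fpair v2 v1 v0) (FAnd (fentry (tnum 3) v0 (TSucc (TSucc v2)))
                               (fentry (tnum 6) v0 (TSucc (TSucc v1))))).

(* variables, in order of quantification: a b d c *)
Definition binary_clause (tag : nat) (phi : formula) : formula := fball 0 4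
  (fimp (fpair v3 v2 v1) (fimp (fpair (tnum tag) v1 v0)
    (fimp (fprogram v3) (fimp (fprogram v2) phi)))).

(* a b d c; n u v w *)
Definition clause_pair : formula := binary_clause 5 (fball 4 4
  (FAnd (fimp (fentry v7 v3 (tnum 1)) (fentry v4 v3 (tnum 1)))
    (FAnd (fimp (fentry v6 v3 (tnum 1)) (fentry v4 v3 (tnum 1)))
      (fimp (fentry v7 v3 (TSucc (TSucc v2))) (fimp (fentry v6 v3 (TSucc (TSucc v1)))
        (fimp (fpair v2 v1 v0) (fentry v4 v3 (TSucc (TSucc v0))))))))).

(* a b d c; n u v *)
Definition clause_comp : formula := binary_clause 6 (fball 4 3
  (FAnd (fimp (fentry v5 v2 (tnum 1)) (fentry v3 v2 (tnum 1)))
    (fimp (fentry v5 v2 (TSucc (TSucc v1))) (fimp (fentry v6 v1 v0) (fentry v3 v2 v0))))).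

(* a b d c; x n v *)
Definition clause_prec0 : formula := binary_clause 7 (fball 4 3
  (fimp (fpair v2 TZero v1) (fimp (fentry v6 v2 v0) (fentry v3 v1 v0)))).

(* a b d c; x k m m' with m = <x, k> and m' = <x, k + 1>; y z1 z v with z = <x, <k, y>> *)
Definition clause_precS : formula := binary_clause 7 (fball 4 4
  (fimp (fpair v3 v2 v1) (fimp (fpair v3 (TSucc v2) v0)
    (FAnd (fimp (fentry v4 v1 (tnum 1)) (fentry v4 v0 (tnum 1)))
      (fball 8 4 (fimp (fentry v8 v5 (TSucc (TSucc v3)))
        (fimp (fpair v6 v3 v2) (fimp (fpair v7 v2 v1)
          (fimp (fentry (TVar 10) v1 v0) (fentry v8 v4 v0)))))))))).

(* a c n; y z with z = <n, y>; i w with w = <n, i> *)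
Definition clause_mu : formula := fball 0 3
  (fimp (fpair (tnum 8) v2 v1) (fimp (fprogram v2)
    (FAnd (FNot (fentry v1 v0 TZero))
      (fball 3 2 (fimp (fpair v2 v1 v0)
        (FAnd (fimp (fentry v3 v2 (TSucc (TSucc v1)))
                (FAnd (fentry v4 v0 (tnum 2))
                  (FBAll v1 (FBAll v1 (fimp (fpair v4 v1 v0)
                    (FAnd (FNot (fentry v6 v0 (tnum 2))) (FNot (fentry v6 v0 (tnum 1)))))))))
              (fimp (fentry v3 v2 (tnum 1))
                (FOr (FNot (fentry v4 v0 (tnum 2)))
                  (FBEx v1 (FBEx v1 (FAnd (fpair v4 v1 v0)
                    (fentry v6 v0 (tnum 1))))))))))))).

(* v4 is the program x; a t with a = q 0 and t = q 1; i r r' with r = q i and r' = q (i + 1) *)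
Definition clause_refutation : formula := fball 0 2
  (fimp (fseq TZero v1) (fimp (fseq (tnum 1) v0)
    (FOr (FAnd (FNot (fentry v6 v1 (tnum 2))) (FNot (fentry v6 v1 (tnum 3))))
      (FOr (FAnd (fextension 1 0) (FAnd (fentry v6 v0 (tnum 3)) (FNot (fentry v6 v1 (tnum 3)))))
        (FAnd (FEq v1 TZero) (fball 2 3 (fimp (fseq v2 v1) (fimp (fseq (TSucc v2) v0)
          (FAnd (fentry (TVar 9) v1 (tnum 3)) (fextension 1 0)))))))))).

Definition clauses : seq formula :=
  [:: clause_const; clause_succ; clause_proj; clause_pair; clause_comp;
      clause_prec0; clause_precS; clause_mu; clause_refutation].

Definition theta : formula := foldr FAnd (FEq TZero TZero) clauses.

Lemma bounded_theta : bounded theta. Proof. by []. Qed.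
Lemma flat_theta : flat theta. Proof. by []. Qed.

(* [theta] ignores the three variables between the stage [j] and the program [x]. *)
Definition stage (p : nat -> nat) (j x : nat) : Prop := sat p [:: j; 0; 0; 0; x] theta.

(** A stage past [a], [b] and the two pairs discharges the guards of the header. It can be taken
    beyond any [j], which leaves room for the inner quantifiers bounded by the same stage. *)
Lemma binary_clauseP p tag phi :
  (forall j, exists s, sat p (j :: s) (binary_clause tag phi)) ->
  forall a b (c := cpair tag (cpair a b)), table_of p a 0 <> 0 -> table_of p b 0 <> 0 ->
  forall j, exists2 j', j <= j' & exists s, sat p [:: c, cpair a b, b, a, j' & s] phi.
Proof.
move=> H a b c Ea Eb j; have [s Hs] := H (j + a + b + cpair a b + c).+1.
exists (j + a + b + cpair a b + c).+1; first by lia.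
exists s; have := Hs a _ b _ (cpair a b) _ c _; rewrite /= !orNp.
have cpE d x y : d = cpair x y -> d + d = (x + y) * (x + y).+1 + y + y.
  by move=> /double_pair_eq.
have tE n : term_val p [:: c, cpair a b, b, a, (j + a + b + cpair a b + c).+1 & s] (tnum n) = n.
  by rewrite /tnum; elim: n => //= n ->.
rewrite tE; apply; try lia; try exact: cpE.
all: by move: Ea Eb; rewrite /table_of /double_pair.
Qed.

Lemma or_not_elim (A B : Prop) : ~ A \/ B -> A -> B.
Proof. by rewrite orNp. Qed.

Lemma clause_constP p s :
  (forall j, sat p (j :: s) clause_const) <->
  forall k n, table_of p (cpair 0 k) n = k.+2.
Proof.
split=> [H k n|H j k _ c _ n _]; last first.
  by rewrite /= orNp => /double_pair_eq ->; apply: H.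
have := H (k + cpair 0 k + n).+1 k _ (cpair 0 k) _ n _; rewrite /= orNp.
by apply; try lia; apply/double_pair_eq.
Qed.

Lemma clause_succP p s :
  (forall j, sat p (j :: s) clause_succ) <-> forall n, table_of p (cpair 1 0) n = n.+3.
Proof. by split=> [H n|H j n _]; [apply: (H n.+1 n (leqnn _))|apply: H]. Qed.

Lemma clause_projP p s :
  (forall j, sat p (j :: s) clause_proj) <->
  (forall u v, table_of p (cpair 2 0) (cpair u v) = u.+2) /\
  (forall u v, table_of p (cpair 3 0) (cpair u v) = v.+2).
Proof.
split=> [H|[H1 H2] j u _ v _ n _]; last first.
  by rewrite /= orNp => /double_pair_eq ->; split; [apply: H1|apply: H2].
have G u v : table_of p (cpair 2 0) (cpair u v) = u.+2 /\
             table_of p (cpair 3 0) (cpair u v) = v.+2.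
  have := H (u + v + cpair u v).+1 u _ v _ (cpair u v) _; rewrite /= orNp.
  by apply; try lia; apply/double_pair_eq.
by split=> u v; case: (G u v).
Qed.

Lemma clause_pairP p s :
  (forall j, sat p (j :: s) clause_pair) <->
  forall a b n (c := cpair 5 (cpair a b)), table_of p a 0 <> 0 -> table_of p b 0 <> 0 ->
    [/\ table_of p a n = 1 -> table_of p c n = 1, table_of p b n = 1 -> table_of p c n = 1
      & forall u v, table_of p a n = u.+2 -> table_of p b n = v.+2 ->
          table_of p c n = (cpair u v).+2].
Proof.
split=> [H a b n c Ea Eb|V j a _ b _ d _ c _].
  have G u v w : (table_of p a n = 1 -> table_of p c n = 1) /\
      (table_of p b n = 1 -> table_of p c n = 1) /\
      (table_of p a n = u.+2 -> table_of p b n = v.+2 -> w + w = double_pair u v ->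
       table_of p c n = w.+2).
    have {H} H j : exists s, sat p (j :: s) clause_pair by exists s.
    have [j jj [s' Hs]] := binary_clauseP H Ea Eb (n + u + v + w).+1.
    by have := Hs n _ u _ v _ w _; rewrite /= !orNp; apply; lia.
  split=> [||u v Eu Ev]; [by case: (G 0 0 0)|by case: (G 0 0 0) => _ []|].
  by have [_ [_ ]] := G u v (cpair u v); apply => //; apply/double_pair_eq.
rewrite /= !orNp => /double_pair_eq -> /double_pair_eq -> Ea Eb n _ u _ v _ w _.
have [H1 H2 H3] := V a b n Ea Eb; rewrite !orNp; split=> //; split=> //.
by move=> Eu Ev /double_pair_eq ->; apply: H3.
Qed.

Lemma clause_compP p s :
  (forall j, sat p (j :: s) clause_comp) <->
  forall a b n (c := cpair 6 (cpair a b)), table_of p a 0 <> 0 -> table_of p b 0 <> 0 ->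
    (table_of p b n = 1 -> table_of p c n = 1) /\
    (forall u, table_of p b n = u.+2 -> table_of p c n = table_of p a u).
Proof.
split=> [H a b n c Ea Eb|V j a _ b _ d _ c _].
  have G u v : (table_of p b n = 1 -> table_of p c n = 1) /\
      (table_of p b n = u.+2 -> table_of p a u = v -> table_of p c n = v).
    have {H} H j : exists s, sat p (j :: s) clause_comp by exists s.
    have [j jj [s' Hs]] := binary_clauseP H Ea Eb (n + u + v).+1.
    by have := Hs n _ u _ v _; rewrite /= !orNp; apply; lia.
  split=> [|u Eu]; first by case: (G 0 0).
  by have [_] := G u (table_of p a u); apply.
rewrite /= !orNp => /double_pair_eq -> /double_pair_eq -> Ea Eb n _ u _ v _.
have [H1 H2] := V a b n Ea Eb; rewrite !orNp; split=> //.
by move=> Eu <-; apply: H2.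
Qed.

Lemma clause_prec0P p s :
  (forall j, sat p (j :: s) clause_prec0) <->
  forall a b x (c := cpair 7 (cpair a b)), table_of p a 0 <> 0 -> table_of p b 0 <> 0 ->
    table_of p c (cpair x 0) = table_of p a x.
Proof.
split=> [H a b x c Ea Eb|V j a _ b _ d _ c _].
  have {H} H j : exists s, sat p (j :: s) clause_prec0 by exists s.
  have [j jj [s' Hs]] := binary_clauseP H Ea Eb (x + cpair x 0 + table_of p a x).+1.
  have := Hs x _ (cpair x 0) _ (table_of p a x) _; rewrite /= !orNp.
  by apply; try lia; try apply/double_pair_eq.
rewrite /= !orNp => /double_pair_eq -> /double_pair_eq -> Ea Eb x _ n _ v _.
by rewrite !orNp => /double_pair_eq -> <-; apply: V.
Qed.

Lemma clause_precSP p s :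
  (forall j, sat p (j :: s) clause_precS) <->
  forall a b x (c := cpair 7 (cpair a b)), table_of p a 0 <> 0 -> table_of p b 0 <> 0 ->
  forall k,
    (table_of p c (cpair x k) = 1 -> table_of p c (cpair x k.+1) = 1) /\
    forall y, table_of p c (cpair x k) = y.+2 ->
      table_of p c (cpair x k.+1) = table_of p b (cpair x (cpair k y)).
Proof.
split=> [H a b x c Ea Eb k|V j a _ b _ d _ c _].
  have {H} H j : exists s, sat p (j :: s) clause_precS by exists s.
  pose m := cpair x k; pose m' := cpair x k.+1.
  have G y (z1 := cpair k y) (z := cpair x z1) (v := table_of p b z) :
      (table_of p c m = 1 -> table_of p c m' = 1) /\
      (table_of p c m = y.+2 -> table_of p c m' = v).
    have [j jj [s' Hs]] := binary_clauseP H Ea Eb (x + k + m + m' + y + z1 + z + v).+1.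
    have := Hs x _ k _ m _ m' _; rewrite /= !orNp => [][]; try lia;
      try exact/double_pair_eq.
    move=> H1 H2; split=> // Ey; have := H2 y _ z1 _ z _ v _; rewrite /= !orNp.
    by apply; try lia; try exact: Ey; try exact/double_pair_eq.
  by split=> [|y Ey]; [case: (G 0)|case: (G y) => _; apply].
rewrite /= !orNp => /double_pair_eq -> /double_pair_eq -> Ea Eb x _ k _ m _ m' _.
rewrite !orNp => /double_pair_eq -> /double_pair_eq ->.
have [H1 H2] := V a b x Ea Eb k; split=> // y _ z1 _ z _ v _.
by rewrite !orNp => Ey /double_pair_eq -> /double_pair_eq -> <-; apply: H2.
Qed.

Lemma clause_muP p s :
  (forall j, sat p (j :: s) clause_mu) <->
  forall a n (c := cpair 8 a), table_of p a 0 <> 0 ->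
    [/\ table_of p c n <> 0,
        forall y, table_of p c n = y.+2 ->
          table_of p a (cpair n y) = 2 /\
          forall i, i < y -> table_of p a (cpair n i) <> 2 /\ table_of p a (cpair n i) <> 1
      & table_of p c n = 1 -> forall y,
          table_of p a (cpair n y) <> 2 \/
          exists2 i, i < y & table_of p a (cpair n i) = 1].
Proof.
(* In the clause the code [w] of [(n, i)] ranges below the code [z] of [(n, y)]; since pairing is
   increasing in its second argument, this covers all [i < y]. *)
have ltp n i y : i < y -> cpair n i < cpair n y.
  have := cpair_double n i; have := cpair_double n y; nia.
split=> [H a n c Ea|V j a _ c _ n _].
  have G y (z := cpair n y) : table_of p c n <> 0 /\
      (table_of p c n = y.+2 -> table_of p a z = 2 /\
        forall i, i < y -> forall w, w < z -> w + w = double_pair n i ->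
          table_of p a w <> 2 /\ table_of p a w <> 1) /\
      (table_of p c n = 1 -> table_of p a z <> 2 \/
        exists2 i, i < y & exists2 w, w < z & w + w = double_pair n i /\ table_of p a w = 1).
    pose J := (a + c + n + y + z).+1.
    have [aJ [cJ [nJ [yJ zJ]]]] : a < J /\ c < J /\ n < J /\ y < J /\ z < J by rewrite /J; lia.
    have e8 : c + c = double_pair 8 a by apply/double_pair_eq.
    have ez : z + z = double_pair n y by apply/double_pair_eq.
    move: (H J a aJ c cJ n nJ) => /= /or_not_elim/(_ e8)/or_not_elim/(_ Ea)[H1 /(_ y yJ z zJ)].
    move=> /or_not_elim/(_ ez)[/or_not_elim H3 /or_not_elim H4]; do 2!split=> //.
    move=> /H3[H5 H6]; split=> // i iy w wz; exact: or_not_elim (H6 i iy w wz).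
  split=> [|y Ey|E1 y]; first by case: (G 0).
    have [_ [/(_ Ey)[H1 H2] _]] := G y; split=> // i iy.
    by apply: H2 iy _ (ltp _ _ _ iy) _; apply/double_pair_eq.
  have [_ [_ /(_ E1)[H1|[i iy [w wz [/double_pair_eq -> H1]]]]]] := G y; first by left.
  by right; exists i.
rewrite /= 2!orNp => /double_pair_eq -> Ea; have [H1 H2 H3] := V a n Ea.
split=> // y _ z _; rewrite -[_ \/ _]/(~ (z + z = double_pair n y) \/ _) orNp.
move=> /double_pair_eq ->; split.
  rewrite orNp => /H2[H4 H5]; split=> // i iy w wz; rewrite orNp => /double_pair_eq ->.
  exact: H5.
rewrite orNp => /H3/(_ y)[H4|[i iy H4]]; first by left.
right; exists i => //; exists (cpair n i); first exact: ltp.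
by split=> //; apply/double_pair_eq.
Qed.

Lemma clause_refutationP p x :
  (forall j, sat p [:: j; 0; 0; 0; x] clause_refutation) <->
  hyperjump_refutation (table_of p) (sequence_of p) x.
Proof.
pose E := table_of p; pose q := sequence_of p.
pose ext s := sat p s (fextension 1 0).
pose body J a t := (E x a <> 2 /\ E x a <> 3) \/
  (ext [:: t; a; J; 0; 0; 0; x] /\ (E x t = 3 /\ E x a <> 3) \/
   (a = 0 /\ forall i, i < J -> forall r, r < J -> forall r', r' < J ->
      ~ (q i = r) \/ (~ (q i.+1 = r') \/
        (E x r = 3 /\ ext [:: r', r, i, t, a, J, 0, 0, 0, x & [::]])))).
have extE s r r' : ext [:: r', r & s] <-> code_extension r r' by apply: sat_extension.
split=> [H|R J a _ t _].
  have st J : q 0 < J -> q 1 < J -> body J (q 0) (q 1).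
    move=> aJ tJ.
    exact: or_not_elim (or_not_elim (H J (q 0) aJ (q 1) tJ) erefl) erefl.
  (* The first two alternatives do not depend on the stage; if both fail, every large enough stage
     gives its instance of the third. *)
  apply: contrapT => nR.
  have third i : q 0 = 0 /\ (E x (q i) = 3 /\ code_extension (q i) (q i.+1)).
    pose J := (q 0 + q 1 + i + q i + q i.+1).+1.
    have [aJ [tJ [iJ [rJ r'J]]]] : q 0 < J /\ q 1 < J /\ i < J /\ q i < J /\ q i.+1 < J.
      by rewrite /J; lia.
    case: (st J aJ tJ) => [D|[[/extE D1 D2]|[q0 /(_ i iJ _ rJ _ r'J)]]].
    - by case: nR; constructor 1.
    - by case: nR; constructor 2.
    - by move=> /or_not_elim/(_ erefl)/or_not_elim/(_ erefl)[D /extE].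
  by apply: nR; constructor 3; split=> [|i]; [case: (third 0)|case: (third i)].
change (~ (q 0 = a) \/ (~ (q 1 = t) \/ body J a t)).
rewrite !orNp => <- <-; case: R => [D|[D1 D2]|[q0 D]]; [by left|right; left|right; right].
  by split=> //; apply/extE.
split=> // i _ r _ r' _; rewrite !orNp => <- <-; have [D1 D2] := D i.
by split=> //; apply/extE.
Qed.

Lemma stageP p x :
  (forall j, stage p j x) <->
  valid_table (table_of p) /\ hyperjump_refutation (table_of p) (sequence_of p) x.
Proof.
pose all C := forall j, sat p (j :: [:: 0; 0; 0; x]) C.
have sE : (forall j, stage p j x) <->
    all clause_const /\ all clause_succ /\ all clause_proj /\ all clause_pair /\
    all clause_comp /\ all clause_prec0 /\ all clause_precS /\ all clause_mu /\
    all clause_refutation.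
  split=> [H|[c0 [c1 [c2 [c3 [c4 [c5 [c6 [c7 c8]]]]]]]] j]; last first.
    exact: (conj (c0 j) (conj (c1 j) (conj (c2 j) (conj (c3 j) (conj (c4 j)
      (conj (c5 j) (conj (c6 j) (conj (c7 j) (conj (c8 j) (erefl 0)))))))))).
  by do 8?[split; first by move=> j; case: (H j) => [c0 [c1 [c2 [c3 [c4 [c5 [c6 [c7 [c8 _]]]]]]]]]];
    move=> j; case: (H j) => [c0 [c1 [c2 [c3 [c4 [c5 [c6 [c7 [c8 _]]]]]]]]].
rewrite sE /all clause_constP clause_succP clause_projP clause_pairP clause_compP.
rewrite clause_prec0P clause_precSP clause_muP clause_refutationP.
split=> [[c0 [c1 [[c2 c2'] [c3 [c4 [c5 [c6 [c7 c8]]]]]]]]|].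
  split=> //; split=> // a b y c Ea Eb; split; first exact: c5.
  exact: c6.
case=> -[c0 c1 c2 c2' c3 c4 c5 c6] c7.
do 5!(split; first by []).
split; first by move=> a b y c Ea Eb; case: (c5 a b y Ea Eb).
by split; first by move=> a b y c Ea Eb; case: (c5 a b y Ea Eb).
Qed.

(** * The partition and its complexity *)

(** Bounding the codes [a] and [b] avoids unbounded quantifiers over them, and bounding the values
    by [h] is what compactness needs. Stages and oracle answers are checked only below [k]. *)
Definition level (X : set nat) (x k : nat) (h : nat -> nat) : Prop :=
  exists2 a, a < h k.+1 & exists2 b, b < h k.+1 &
    (forall i, i < k -> beta a b i <= h i) /\
    ((forall j, j < k -> stage (beta a b) j x) /\
     forall j, j < k -> table_of (beta a b) (cpair 4 0) j = (`[< X j >] : nat).+2).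

Lemma level_local X x k h h' : (forall i, i <= k.+1 -> h i = h' i) ->
  level X x k h -> level X x k h'.
Proof.
move=> hh' [a ah [b bh [H1 H2]]]; exists a; first by rewrite -hh'.
exists b; first by rewrite -hh'.
by split=> // i ik; rewrite -hh' ?H1 //; lia.
Qed.

Lemma stage_continuous p j x :
  exists N, forall p', (forall i, i < N -> p' i = p i) -> stage p' j x <-> stage p j x.
Proof. exact: bounded_continuous bounded_theta. Qed.

(** Compactness yields a limit of the coded functions. Each stage and each oracle answer depends on
    finitely many values and so passes to the limit; no growth of [h] is assumed. *)
Lemma level_sound X x h : (forall k, level X x k h) -> ~ hyperjump X x.
Proof.
move=> H; have /choice[ab Hab] : forall k, exists ab : nat * nat,
    (forall i, i < k -> beta ab.1 ab.2 i <= h i) /\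
    ((forall j, j < k -> stage (beta ab.1 ab.2) j x) /\
     forall j, j < k -> table_of (beta ab.1 ab.2) (cpair 4 0) j = (`[< X j >] : nat).+2).
  by move=> k; have [a _ [b _ Hk]] := H k; exists (a, b).
have [p Hp] := compactness (fun k => (Hab k).1).
apply/hyperjumpPn; exists (table_of p), (sequence_of p).
have /stageP[V R] : forall j, stage p j x.
  move=> j; have [N HN] := stage_continuous p j x; have [k jk Hk] := Hp N j.+1.
  by apply/(HN _ Hk); apply: (Hab k).2.1.
split=> // j; have [k jk Hk] := Hp (double_pair (cpair 4 0) j).+1 j.+1.
by rewrite -((Hab k).2.2 j jk) /table_of Hk.
Qed.

(** A single function [p] passes all stages, and [h] only has to exceed its values and the codes of
    sufficiently long initial segments of it. *)
Lemma level_complete X x : ~ hyperjump X x ->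
  exists q : nat -> nat, forall h, (forall k, q k < h k) -> forall k, level X x k h.
Proof.
move/hyperjumpPn=> [E [r [V EX R]]].
(* Inverts the interleaving: odd positions carry the sequence, even ones the table. *)
pose p m := if odd m then r m./2 else E (pfst m./2) (psnd m./2).
have pE : table_of p = E.
  apply/funext => c; apply/funext => n.
  by rewrite /table_of /p double_pairE addnn odd_double doubleK !cpairE.
have pr : sequence_of p = r.
  by apply/funext => i; rewrite /sequence_of /p addnn /= odd_double /= uphalf_double.
have st : forall j, stage p j x by apply/stageP; rewrite pE pr.
have /choice[ab Hab] : forall k, exists ab : nat * nat,
    (forall i, i < k -> beta ab.1 ab.2 i = p i) /\
    ((forall j, j < k -> stage (beta ab.1 ab.2) j x) /\
     forall j, j < k -> table_of (beta ab.1 ab.2) (cpair 4 0) j = (`[< X j >] : nat).+2).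
  move=> k.
  have [|L HL] := @bounded_collect k (fun j N => forall p', (forall i, i < N -> p' i = p i) ->
      stage p' j x /\ table_of p' (cpair 4 0) j = (`[< X j >] : nat).+2).
    move=> j _; have [N HN] := stage_continuous p j x.
    exists (N + (double_pair (cpair 4 0) j).+1) => p' pp; split.
      by apply/HN => // i iN; apply: pp; lia.
    by rewrite /table_of pp -?EX -?pE //; lia.
  have [a [b Hb]] := beta_surj p (k + L); exists (a, b) => /=; split.
    by move=> i ik; apply: Hb; lia.
  by split=> j /HL[N NL /(_ (beta a b))[]] // i iN; apply: Hb; lia.
(* The codes for level [k] are compared with [h k.+1], hence the predecessor. *)
exists (fun k => p k + (ab k.-1).1 + (ab k.-1).2) => h hq k; have [H1 H2] := Hab k.
exists (ab k).1; first by have := hq k.+1; rewrite /=; lia.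
exists (ab k).2; first by have := hq k.+1; rewrite /=; lia.
by split=> // i ik; rewrite H1 //; have := hq i; lia.
Qed.

(** * The defining formulas and their classes *)

Lemma term_val_tnum f s n : term_val f s (tnum n) = n.
Proof. by elim: n => //= n ->. Qed.

(** Stray variables go to [TZero], matching the environments of length one and two, where they read
    as 0; this makes the substitutions realizable. *)
Definition at_var0 (i : nat) : term := if i is 0 then TVar 0 else TZero.
Definition at_pair (d : term) (i : nat) : term :=
  match i with 0 => TVar 0 | 1 => d | _ => TZero end.

Lemma realizable_at_var0 : realizable at_var0.
Proof. by move=> f s; exists [:: nth 0 s 0] => -[|[]]. Qed.

Lemma realizable_at_pair d : realizable (at_pair d).
Proof. by move=> f s; exists [:: nth 0 s 0; term_val f s d] => -[|[|[]]]. Qed.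

(** [forall k, level X x k (fun i => f (d + i))] for the free variables [x] and [d], where the
    formula [H] defines [X]. *)
Definition level_formula (H : formula) : formula :=
  FAll (FBEx (TApp (TAdd v2 (TSucc v0))) (FBEx (TApp (TAdd v3 (TSucc v1)))
    (FAnd (FBAll v2 (FBEx (TSucc (TApp (TAdd v5 v0))) (beta_graph v3 v2 v1 v0)))
      (FAnd (FBAll v2 (beta_formula 2 1 theta))
        (FBAll v2
          (FOr (FAnd (beta_graph v2 v1 (tpair2 (tnum 10) v0) (tnum 3))
                 (formula_subst at_var0 H))
               (FAnd (beta_graph v2 v1 (tpair2 (tnum 10) v0) (tnum 2))
                 (FNot (formula_subst at_var0 H))))))))).

Lemma sat_level_formula f H X x d : (forall j, sat f [:: j] H <-> X j) ->
  sat f [:: x; d] (level_formula H) <-> forall k, level X x k (fun i => f (d + i)).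
Proof.
move=> HX.
have H1 i b a s : sat f [:: i, b, a & s]
    (FBEx (TSucc (TApp (TAdd v5 v0))) (beta_graph v3 v2 v1 v0)) <->
    beta a b i <= f (nth 0 s 2 + i).
  split=> [[v vf /sat_beta_graph /= ->]//|le]; exists (beta a b i) => //.
  exact/sat_beta_graph.
have H2 j b a s : sat f [:: j, b, a & s] (beta_formula 2 1 theta) <->
    sat (beta a b) [:: j, b, a & s] theta by apply: sat_beta_formula flat_theta.
have H3 j b a s :
    sat f [:: j, b, a & s] (FOr (FAnd (beta_graph v2 v1 (tpair2 (tnum 10) v0) (tnum 3))
                 (formula_subst at_var0 H))
               (FAnd (beta_graph v2 v1 (tpair2 (tnum 10) v0) (tnum 2))
                 (FNot (formula_subst at_var0 H)))) <->
    table_of (beta a b) (cpair 4 0) j = (`[< X j >] : nat).+2.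
  have e : env_subst f at_var0 [:: j, b, a & s] [:: j] by case=> [|[]].
  have bt v : sat f [:: j, b, a & s] (beta_graph v2 v1 (tpair2 (tnum 10) v0) (tnum v)) <->
      table_of (beta a b) (cpair 4 0) j = v.
    by rewrite sat_beta_graph term_val_tnum.
  change ((sat f [:: j, b, a & s] (beta_graph v2 v1 (tpair2 (tnum 10) v0) (tnum 3)) /\
           sat f [:: j, b, a & s] (formula_subst at_var0 H)) \/
          (sat f [:: j, b, a & s] (beta_graph v2 v1 (tpair2 (tnum 10) v0) (tnum 2)) /\
           ~ sat f [:: j, b, a & s] (formula_subst at_var0 H)) <->
          table_of (beta a b) (cpair 4 0) j = (`[< X j >] : nat).+2).
  rewrite !bt (sat_subst _ e) HX; case: asboolP => Xj /=.
    by split=> [[[]//|[]//]|->]; left.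
  by split=> [[[]//|[]//]|->]; right.
split=> S k; have [a ak [b bk [S1 [S2 S3]]]] := S k; exists a => //; exists b => //.
  split=> [i /S1/H1//|]; split=> [j /S2/H2//|j /S3/H3//].
by split=> [i /S1 ?|]; [apply/H1|split=> [j /S2 ?|j /S3 ?]; [apply/H2|apply/H3]].
Qed.

(** Defines the [m]-th iterated hyperjump when [f] grows fast enough. *)
Fixpoint hyperjump_formula (m : nat) : formula :=
  if m is m'.+1 then
    FNot (formula_subst (at_pair (TSucc (TSucc v0))) (level_formula (hyperjump_formula m')))
  else FLt TZero TZero.

(** The oracle formula occurs both positively and negatively, but a Sigma formula is Delta one level
    up. Bounded quantifiers preserve the class, and the outer universal one is absorbed. *)
Lemma level_formula_pi m H : sigma_class m H -> pi_class m.+1 (level_formula H).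
Proof.
move=> SH; have [_ Psub Pand Por Pbex Pball] := pi_closed m.+1.
have Pb phi : bounded phi -> pi_class m.+1 phi by case/(bounded_delta m.+1).
have [SH' PH] := delta_sigmaS SH.
have PnH := pi_not SH'.
have S := Psub _ _ realizable_at_var0; have {}PH := S _ PH; have {}PnH := S _ PnH.
apply: pi_all; apply/Pbex/Pbex/Pand; first exact: Pb.
apply: (Pand (FBAll _ _) (FBAll _ _)).
  apply: Pball; apply: Pb; exact: bounded_beta_formula bounded_theta.
by apply: (Pball); apply: (Por (FAnd _ _) (FAnd _ _)); apply: (Pand) => //; apply: Pb.
Qed.

Lemma hyperjump_formula_sigma m : sigma_class m (hyperjump_formula m).
Proof.
elim: m => [|m IH]; first by have [] := @bounded_delta 0 (hyperjump_formula 0) isT.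
apply: (closed_subst (pi_closed m.+1)); first exact: realizable_at_pair.
exact: level_formula_pi.
Qed.

Definition level_formula_at (m d : nat) : formula :=
  formula_subst (at_pair (tnum d)) (level_formula (hyperjump_formula m)).

Definition fiff (phi psi : formula) : formula := FAnd (fimp phi psi) (fimp psi phi).

Fixpoint partition_formula (n : nat) : formula :=
  if n is m.+1 then
    FAnd (FBAll (TApp TZero) (fiff (level_formula_at m 1) (level_formula_at m 2)))
         (partition_formula m)
  else FEq TZero TZero.

(** The level formulas for [n] are Pi at [n.+1], hence Delta at [n.+2], a class closed under
    equivalences and under the quantifier bounded by [f 0]. *)
Lemma partition_formula_delta n : delta_class n.+1 (partition_formula n).
Proof.
elim: n => [|n IH]; first exact: bounded_delta.
have [_ Dsub Dand Dor Dbex Dball] := delta_closed n.+2.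
have D d : delta_class n.+2 (level_formula_at n d).
  apply: Dsub; first exact: realizable_at_pair.
  have := level_formula_pi (hyperjump_formula_sigma n).
  move/delta_sigmaS/delta_not; apply: (closed_equiv (delta_closed n.+2)) => f s /=.
  by split=> [/contrapT//|H /(_ H)].
apply: (Dand); last exact: delta_leq IH.
by apply: Dball; apply: (Dand); apply: Dor => //; apply: delta_not.
Qed.

Notation hyperjump_iter m := (iter m hyperjump set0).

Definition correct (m : nat) (f : nat -> nat) : Prop :=
  forall x, sat f [:: x] (hyperjump_formula m) <-> hyperjump_iter m x.

Lemma correct0 f : correct 0 f. Proof. by []. Qed.

Lemma sat_level_at m d f x : correct m f ->
  sat f [:: x] (level_formula_at m d) <->
  forall k, level (hyperjump_iter m) x k (fun i => f (d + i)).
Proof.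
move=> fm; have e : env_subst f (at_pair (tnum d)) [:: x] [:: x; d].
  by case=> [|[|[]]] //=; rewrite term_val_tnum.
by rewrite (sat_subst _ e); apply: sat_level_formula.
Qed.

Lemma correctS m f : correct m f ->
  (forall x, (forall k, level (hyperjump_iter m) x k (fun i => f (x.+2 + i))) <->
             ~ hyperjump_iter m.+1 x) ->
  correct m.+1 f.
Proof.
move=> fm H x.
have e : env_subst f (at_pair (TSucc (TSucc v0))) [:: x] [:: x; x.+2] by case=> [|[|[]]].
change (~ sat f [:: x] (formula_subst (at_pair (TSucc (TSucc v0)))
  (level_formula (hyperjump_formula m))) <-> hyperjump_iter m.+1 x).
rewrite (sat_subst _ e) (sat_level_formula _ _ fm) H.
by split=> [/contrapT//|Hx /(_ Hx)].
Qed.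

Definition in_partition (n : nat) (f : nat -> nat) : Prop :=
  forall m, m < n -> forall x, x < f 0 ->
    sat f [:: x] (level_formula_at m 1) <-> sat f [:: x] (level_formula_at m 2).

Lemma sat_partition_formula n f : sat f [::] (partition_formula n) <-> in_partition n f.
Proof.
elim: n => [|n IH]; first by split.
change ((forall x, x < f 0 -> sat f [:: x] (fiff (level_formula_at n 1) (level_formula_at n 2)))
  /\ sat f [::] (partition_formula n) <-> in_partition n.+1 f).
rewrite IH; split=> [[H1 H2] m|H].
  rewrite ltnS leq_eqVlt => /orP[/eqP->|/H2//] x /H1 [S1 S2].
  by split; apply: or_not_elim.
split=> [x xf|m mn]; last by apply: H; lia.
have [S1 S2] := H n (leqnn _) x xf.
change ((~ sat f [:: x] (level_formula_at n 1) \/ sat f [:: x] (level_formula_at n 2)) /\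
        (~ sat f [:: x] (level_formula_at n 2) \/ sat f [:: x] (level_formula_at n 1))).
by rewrite !orNp.
Qed.

(** * Homogeneous sets *)

Lemma ramsey_step f : (forall i, f i < f i.+1) -> ramsey_space f.
Proof.
move=> H x y; elim: y => // y IH; rewrite ltnS leq_eqVlt => /orP[/eqP->//|/IH].
by move=> /ltn_trans; apply.
Qed.

Lemma ramsey_comp f g : ramsey_space f -> ramsey_space g -> ramsey_space (f \o g).
Proof. by move=> rf rg x y /rg/rf. Qed.

Lemma ramsey_ge f i : ramsey_space f -> i <= f i.
Proof. by move=> rf; elim: i => // i IH; apply: leq_ltn_trans IH (rf _ _ _). Qed.

Lemma ramsey_leq f i j : ramsey_space f -> i <= j -> f i <= f j.
Proof. by move=> /leq_mono ->. Qed.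

Lemma ramsey_addn d : ramsey_space (addn d).
Proof. by move=> x y; rewrite ltn_add2l. Qed.

(** Deletes [d] elements but keeps the least one, which bounds the [x] that the partition
    controls. *)
Definition skip_after0 (d i : nat) : nat := if i is 0 then 0 else i + d.

Lemma ramsey_skip_after0 d : ramsey_space (skip_after0 d).
Proof. by apply: ramsey_step => -[|i] /=; lia. Qed.

(** Once [f i] is known, only finitely many requirements bear on [f i.+1]; the next element is
    chosen above their sum. *)
Lemma exists_sparse_subset (Q : nat -> nat -> nat -> nat) (n : nat) g :
  ramsey_space g ->
  exists f, [/\ ramsey_space f, infinite_subsets g f &
    forall i m x k, m < n -> x <= f i -> k <= i -> Q m x k < f i.+1].
Proof.
move=> rg.
pose S i v := \sum_(m < n) \sum_(x < v.+1) \sum_(k < i.+1) Q m x k.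
have QS m x k i v : m < n -> x <= v -> k <= i -> Q m x k <= S i v.
  rewrite -[x <= v]ltnS -[k <= i]ltnS => mn xv ki; rewrite /S (bigD1 (Ordinal mn)) //=.
  rewrite (bigD1 (Ordinal xv)) //= (bigD1 (Ordinal ki)) //=; lia.
pose h := fix h i := if i is i'.+1 then h i' + (S i' (g (h i'))).+1 else 0.
have rh : ramsey_space h by apply: ramsey_step => i /=; lia.
exists (g \o h); split; [exact: ramsey_comp|by exists h|].
move=> i m x k mn xf ki; apply: leq_trans (ramsey_ge (h i.+1) rg).
have -> : h i.+1 = h i + (S i (g (h i))).+1 by [].
have := QS m x k i _ mn xf ki; rewrite /=; lia.
Qed.
Arguments exists_sparse_subset : clear implicits.

(** On a sparse enough subset the levels at offsets 1 and 2 both give the true answer, so they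
    agree. *)
Lemma exists_in_partition n g : ramsey_space g ->
  exists f, infinite_subsets g f /\ in_partition n f.
Proof.
move=> rg.
have /choice[Q HQ] : forall mx : nat * nat, exists q : nat -> nat,
    ~ hyperjump_iter mx.1.+1 mx.2 -> forall h, (forall k, q k < h k) ->
    forall k, level (hyperjump_iter mx.1) mx.2 k h.
  move=> [m x] /=; have [Hx|/level_complete[q Hq]] := pselect (hyperjump_iter m.+1 x).
    by exists id.
  by exists q.
have [f [rf fg fQ]] := exists_sparse_subset (fun m x => Q (m, x)) n g rg.
exists f; split=> //.
(* As soon as [x <= f d], sparseness dominates the modulus of [x] from index [d.+1] on. Taking [d]
   to be 0 and 1 settles the partition, and [x.+1] the formulas for the iterates. *)
have lev m x d : m < n -> x <= f d ->
    (forall k, level (hyperjump_iter m) x k (fun i => f (d.+1 + i))) <->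
    ~ hyperjump_iter m.+1 x.
  move=> mn xd; split; first exact: level_sound.
  move=> nx; apply: (HQ (m, x) nx) => k; rewrite addSn; apply: fQ => //.
    by apply: leq_trans xd (ramsey_leq rf _); apply: leq_addr.
  exact: leq_addl.
have cor m : m <= n -> correct m f.
  elim: m => [_|m IH mn]; first exact: correct0.
  apply: correctS; first by apply: IH; lia.
  by move=> x; apply: lev mn _; apply: leq_trans (leqnSn x) (ramsey_ge _ rf).
move=> m mn x xf; have cm := cor m (ltnW mn).
have xf1 : x <= f 1 by have := rf 0 1 isT; lia.
by rewrite !(sat_level_at _ _ cm) (lev m x 0 mn (ltnW xf)) (lev m x 1 mn xf1).
Qed.

(** Below, deleting elements of [f] one at a time turns it into a set which grows fast enough to
    satisfy every [level]; membership in the partition makes all intermediate sets agree. As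
    a single level depends on finitely many values, [f] satisfies it as well. *)
Lemma homogeneous_level n g m : ramsey_space g ->
  infinite_subsets g `<=` in_partition n -> m < n ->
  (forall f, infinite_subsets g f -> correct m f) ->
  forall f, infinite_subsets g f -> forall x, x < f 0 -> ~ hyperjump_iter m.+1 x ->
  forall k, level (hyperjump_iter m) x k (fun i => f i.+1).
Proof.
(* Level [k] reads its function up to [k.+1], that is, [f] up to [k.+2]; no element up to this index
   may be moved. *)
move=> rg gA mn cor f fg x xf /level_complete[q Hq] k; pose K := k.+2.
have [h0 rh0 ghf] := fg.
have rf : ramsey_space f by rewrite -ghf; apply: ramsey_comp.
(* The identity up to [K], and beyond it large enough to dominate [q]. *)
pose h i := if i <= K then i else i + \sum_(l < i) (q l).+1.
have rh : ramsey_space h.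
  apply: ramsey_step => i; rewrite /h big_ord_recr /=.
  by case: (leqP i.+1 K); case: (leqP i K); lia.
have hK i : i <= K -> h i = i by rewrite /h => ->.
have hq i : K < i -> forall l, l < i -> q l < h i.
  by move=> Ki l li; rewrite /h (bigD1 (Ordinal li)) //=; case: leqP Ki => //; lia.
have sub d : infinite_subsets g (f \o (h \o skip_after0 d)).
  exists (h0 \o (h \o skip_after0 d)); last by rewrite -ghf.
  by do !apply: ramsey_comp => //; apply: ramsey_skip_after0.
(* Membership of [f \o (h \o skip_after0 d)] in the partition compares its offsets 1 and 2, which
   are the offsets [d.+1] and [d.+2] of [f \o h]. *)
have step d : (forall k', level (hyperjump_iter m) x k' (fun i => f (h (d.+1 + i)))) <->
              (forall k', level (hyperjump_iter m) x k' (fun i => f (h (d.+2 + i)))).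
  have xd : x < (f \o (h \o skip_after0 d)) 0 by rewrite /= hK.
  have := gA _ (sub d) m mn x xd.
  have cd := cor _ (sub d); rewrite !(sat_level_at _ _ cd).
  have e e' : (fun i => (f \o (h \o skip_after0 d)) (e'.+1 + i)) =
              (fun i => f (h ((d + e').+1 + i))).
    by apply/funext => i; rewrite /= addSn /=; congr (f (h _)); lia.
  by rewrite (e 0) (e 1) addn0 addn1.
have all d : (forall k', level (hyperjump_iter m) x k' (fun i => f (h (1 + i)))) <->
             (forall k', level (hyperjump_iter m) x k' (fun i => f (h (d.+1 + i)))).
  by elim: d => // d ->; apply: step.
apply: (@level_local _ _ _ (fun i => f (h (1 + i)))).
  by move=> i ik; rewrite hK.
(* At offset [K.+1] only the fast growing part of [h] remains, so completeness applies. *)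
apply: ((all K).2 _ k); apply: Hq => l.
by apply: leq_trans (ramsey_ge _ rf); apply: hq; lia.
Qed.

(** Induction on [m]. To decide [x], the first [x.+1] elements are dropped: what remains is again a
    subset of [g] with least element above [x], and skipping that element too gives the offset
    [x.+2]. *)
Lemma homogeneous_correct n g m : ramsey_space g ->
  infinite_subsets g `<=` in_partition n -> m <= n ->
  forall f, infinite_subsets g f -> correct m f.
Proof.
move=> rg gA; elim: m => [_ f _|m IH mn f fg]; first exact: correct0.
have cor : forall f, infinite_subsets g f -> correct m f by apply: IH; lia.
apply: correctS; first exact: cor.
move=> x; split=> [|nx k]; first exact: level_sound.
have [h rh ghf] := fg.
have tail : infinite_subsets g (f \o addn x.+1).
  by exists (h \o addn x.+1); [apply: ramsey_comp (ramsey_addn _)|rewrite -ghf].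
have xf : x < (f \o addn x.+1) 0.
  by rewrite /= addn0; apply: ramsey_ge; rewrite -ghf; apply: ramsey_comp.
have := homogeneous_level rg gA mn cor tail xf nx k.
by apply: level_local => i _ /=; rewrite addnS addSn.
Qed.

Theorem theorem4p10 (n : nat) (I : set (set nat)) :
  turing_jump_ideal I ->
  (forall A : set (nat -> nat), lightface_Delta0 n.+1 A ->
     exists g : nat -> nat, homogeneous_solutions A g /\ I (range g)) ->
  I (iter n hyperjump set0).
Proof.
move=> HI H; have [g [[rg hom] Ig]] := H _ (delta_lightface (partition_formula_delta n)).
(* Some infinite subset of [g] lies in the partition, which rules out the disjoint case of
   homogeneity. *)
have gA : infinite_subsets g `<=` in_partition n.
  have [f [fg fA]] := exists_in_partition n rg.
  case: hom => [sub f' /sub[_ /sat_partition_formula//]|dis].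
  suff : (infinite_subsets g `&` defined_by (partition_formula n)) f by rewrite dis.
  split=> //; split; last exact/sat_partition_formula.
  by have [h rh <-] := fg; apply: ramsey_comp.
have gg : infinite_subsets g g by exists id.
have cn := homogeneous_correct rg gA (leqnn n) gg.
have [_ _ down _] := HI.
apply: down (ideal_definable HI Ig (principal_function_recursive rg erefl)
  (hyperjump_formula n) 1); apply/turing_leP; set S := [set _ | _].
(* [decode_env 1] reads only the first component, so [x] is presented as [cpair x 0]. *)
apply: recursive_ext
  (recursive_oracle (recursive_pair (recursive_id S) (recursive_const S 0))) => x.
by congr nat_of_bool; apply: asbool_equiv_eq; rewrite /S /= cpairE; apply: cn.
Qed.
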